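(* Let $\Gamma$ be a finite simplicial graph such that $G=\mathbb{A}(\Gamma)$ is a non-elementary, irreducible right-angled Artin group with growth rate $\lambda$, and let $H=\langle v\rangle$ be the vertex group of a vertex $v$ of $\Gamma$. If $g_n$ is an element of $G$ of length $n$ chosen uniformly at random, then $$\frac{\mathcal{E}_H(g_n)}{\log n}\to\frac{1}{\log\lambda}$$ in probability as $n\to\infty$.
   Context: For a finite simplicial graph $\Gamma$, the right-angled Artin group is $\mathbb{A}(\Gamma)=\langle v \text{ a vertex of }\Gamma \mid [v,w]=1 \text{ whenever } (v,w)\text{ is an edge of }\Gamma\rangle$. The standard generating set consists of the vertices of $\Gamma$ (and their inverses); $\|g\|$ is the corresponding word length. The opposite graph $\Gamma^{op}$ has the same vertices as $\Gamma$, and its edge set is the complement of that of $\Gamma$. $\mathbb{A}(\Gamma)$ is irreducible if $\Gamma^{op}$ is connected, and non-elementary if $\Gamma$ has at least two vertices. The growth rate is $\lambda=\lim_{n\to\infty}(\#B_n)^{1/n}$ where $B_n=\{g\in G:\|g\|\leq n\}$. Excursion: for a subgroup $H<G$ and a geodesic segment $\gamma$ in the Cayley graph of $G$, set $\mathcal{E}_H(\gamma)=\max_{t\in G}\mathrm{diam}(\gamma\cap tH)$; for $g\in G$, $\mathcal{E}_H(g)$ is the maximum of $\mathcal{E}_H(\gamma)$ over all geodesic segments $\gamma$ joining $1$ and $g$. *)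

(* Defs.v *)
From HB Require Import structures.
From mathcomp Require Import all_boot all_order all_algebra finmap.
From mathcomp Require Import all_classical all_reals all_analysis.

Set Implicit Arguments.
Unset Strict Implicit.
Unset Printing Implicit Defensive.

Import Order.TTheory GRing.Theory Num.Theory.
Import numFieldNormedType.Exports.

Local Open Scope classical_set_scope.
Local Open Scope quotient_scope.
Local Open Scope ring_scope.

(* (x, true) stands for the generator x, (x, false) for its inverse. *)
Definition word (X : Type) := seq (X * bool).

Definition letter_inv (X : Type) (l : X * bool) : X * bool := (l.1, ~~ l.2).

Definition word_inv (X : Type) (w : word X) : word X :=
  rev (map (@letter_inv X) w).

Section Presentation.
Variables (X : choiceType) (rel : set (word X)).

Inductive pres_eq : word X -> word X -> Prop :=
| pres_refl u : pres_eq u u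
| pres_sym u w : pres_eq u w -> pres_eq w u
| pres_trans u v w : pres_eq u v -> pres_eq v w -> pres_eq u w
| pres_cancel u w l : pres_eq (u ++ [:: l; letter_inv l] ++ w) (u ++ w)
| pres_relator u r w : rel r -> pres_eq (u ++ r ++ w) (u ++ w).

Definition pres_eqb (u w : word X) : bool := `[< pres_eq u w >].

Lemma pres_eqb_refl : reflexive pres_eqb.
Proof. by move=> u; apply/asboolP; exact: pres_refl. Qed.

Lemma pres_eqb_sym : symmetric pres_eqb.
Proof. by move=> u w; apply/asboolP/asboolP; exact: pres_sym. Qed.

Lemma pres_eqb_trans : transitive pres_eqb.
Proof.
by move=> v u w /asboolP uv /asboolP vw; apply/asboolP; exact: pres_trans uv vw.
Qed.

Canonical pres_equiv := EquivRel pres_eqb pres_eqb_refl pres_eqb_sym pres_eqb_trans.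

Definition presented := {eq_quot pres_equiv}.

HB.instance Definition _ := Choice.on presented.

Lemma presentedP (u w : word X) :
  (\pi_presented u = \pi_presented w) <-> pres_eq u w.
Proof.
by split=> [/eqmodP/asboolP|uw]; last by apply/eqmodP/asboolP.
Qed.

Lemma pres_catl u v w : pres_eq v w -> pres_eq (u ++ v) (u ++ w).
Proof.
elim=> {v w} [v|v w _|v1 v2 v3 _ h1 _ h2|v w l|v r w rr].
- exact: pres_refl.
- exact: pres_sym.
- exact: pres_trans h1 h2.
- by rewrite !(catA u); exact: pres_cancel.
- by rewrite !(catA u); exact: pres_relator.
Qed.

Lemma pres_catr u v w : pres_eq v w -> pres_eq (v ++ u) (w ++ u).
Proof.
elim=> {v w} [v|v w _|v1 v2 v3 _ h1 _ h2|v w l|v r w rr].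
- exact: pres_refl.
- exact: pres_sym.
- exact: pres_trans h1 h2.
- by rewrite -!catA; exact: pres_cancel.
- by rewrite -!catA; exact: pres_relator.
Qed.

Lemma letter_invK : involutive (@letter_inv X).
Proof. by case=> x b; rewrite /letter_inv /= negbK. Qed.

Lemma word_invK : involutive (@word_inv X).
Proof. by move=> w; rewrite /word_inv map_rev revK mapK //; exact: letter_invK. Qed.

Lemma pres_mulwV w : pres_eq (w ++ word_inv w) [::].
Proof.
elim: w => [|l w IH]; first exact: pres_refl.
have -> : (l :: w) ++ word_inv (l :: w) =
    [:: l] ++ (w ++ word_inv w) ++ [:: letter_inv l].
  by rewrite /word_inv /= rev_cons -cats1 catA.
apply: (@pres_trans _ ([:: l] ++ [::] ++ [:: letter_inv l])).
  exact/pres_catl/pres_catr.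
exact: (@pres_cancel [::] [::]).
Qed.

Definition pres_mul (a b : presented) : presented :=
  \pi_presented (repr a ++ repr b).
Definition pres_one : presented := \pi_presented [::].
Definition pres_inv (a : presented) : presented :=
  \pi_presented (word_inv (repr a)).

Lemma pres_repr (u : word X) : pres_eq (repr (\pi_presented u)) u.
Proof. by apply/presentedP; rewrite reprK. Qed.

Lemma pres_mulA : associative pres_mul.
Proof.
move=> a b c; apply/presentedP.
apply: (@pres_trans _ (repr a ++ repr b ++ repr c)).
  by apply: pres_catl; exact: pres_repr.
by rewrite catA; apply/pres_sym/pres_catr/pres_repr.
Qed.

Lemma pres_mul1 : left_id pres_one pres_mul.
Proof.
move=> a; rewrite -[RHS](reprK a); apply/presentedP.
by rewrite -[X in pres_eq _ X]cat0s; apply/pres_catr/pres_repr.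
Qed.

Lemma pres_mulr1 : right_id pres_one pres_mul.
Proof.
move=> a; rewrite -[RHS](reprK a); apply/presentedP.
by rewrite -[X in pres_eq _ X]cats0; apply/pres_catl/pres_repr.
Qed.

Lemma pres_mulV : left_inverse pres_one pres_inv pres_mul.
Proof.
move=> a; apply/presentedP.
apply: (@pres_trans _ (word_inv (repr a) ++ repr a)).
  exact/pres_catr/pres_repr.
by rewrite -[X in _ ++ X]word_invK; exact: pres_mulwV.
Qed.

Lemma pres_mulrV : right_inverse pres_one pres_inv pres_mul.
Proof.
move=> a; apply/presentedP.
apply: (@pres_trans _ (repr a ++ word_inv (repr a))).
  exact/pres_catl/pres_repr.
exact: pres_mulwV.
Qed.

HB.instance Definition _ := isGroup.Build presented
  pres_mulA pres_mul1 pres_mulr1 pres_mulV pres_mulrV.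

Definition pres_gen (x : X) : presented := \pi_presented [:: (x, true)].

End Presentation.

Section RAAG.
Variables (V : finType) (e : rel V).

Definition raag_relators : set (word V) :=
  [set r | exists v w : V, e v w /\
     r = [:: (v, true); (w, true); (v, false); (w, false)]].

Definition raag : groupType := presented raag_relators.

Definition raag_vertex (v : V) : raag := pres_gen raag_relators v.

Definition raag_gens : set raag :=
  [set g | exists v : V, g = raag_vertex v \/ g = (raag_vertex v)^-1%g].

Definition opposite_graph : rel V := [rel v w | (v != w) && ~~ e v w].

Definition raag_irreducible : Prop :=
  forall v w : V, connect opposite_graph v w.

End RAAG.

Arguments raag_vertex {V} e v.
Arguments raag_gens {V} e.

Definition cyclic_subgroup (G : groupType) (x : G) : set G :=
  [set g | exists k : nat, (g = x ^+ k)%g \/ (g = x ^- k)%g].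

Section CayleyGraph.
(* S is meant to be a symmetric generating set of G. *)
Variables (G : groupType) (S : set G).

Definition has_word_of_size (g : G) (n : nat) : Prop :=
  exists s : seq G,
    [/\ forall x, x \in s -> S x, size s = n & (\prod_(x <- s) x)%g = g].

(* The least length of a word in S representing g; it would be 0 for an
   element outside the subgroup generated by S. *)
Definition word_length (g : G) : nat :=
  xget 0%N [set n | has_word_of_size g n /\
                    forall m, has_word_of_size g m -> (n <= m)%N].

Definition word_dist (x y : G) : nat := word_length (x^-1 * y)%g.

Definition word_ball (n : nat) : set G := [set g | (word_length g <= n)%N].

Definition word_sphere (n : nat) : set G := [set g | word_length g = n].

Definition cayley_edge : rel G := fun x y => `[< S (x^-1 * y)%g >].

(* x :: p lists the successive vertices of a geodesic segment from x to y. *)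
Definition geodesic (x y : G) (p : seq G) : Prop :=
  [/\ path cayley_edge x p, last x p = y & size p = word_dist x y].

(* fset_set A is empty when A is infinite; balls are finite for finite S. *)
Definition growth_rate (R : realType) : R :=
  lim ((#|` fset_set (word_ball n)|%fset%:R : R) `^ (n%:R^-1) @[n --> \oo]).

End CayleyGraph.

Section Excursion.
Variables (R : realType) (G : groupType) (S H : set G).

(* The maxima are taken as suprema in R; they are suprema of bounded sets of
   natural numbers, and sup set0 = 0 gives diameter 0 to the empty set. *)
Definition diam (A : set G) : R :=
  sup [set (word_dist S z.1 z.2)%:R | z in A `*` A].

Definition left_coset (t : G) : set G := [set (t * h)%g | h in H].

Definition path_excursion (gamma : set G) : R :=
  sup [set diam (gamma `&` left_coset t) | t in [set: G]].

Definition excursion (g : G) : R :=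
  sup [set path_excursion [set` 1%g :: p] | p in [set p | geodesic S 1%g g p]].

End Excursion.

Definition uniform_proba (R : realType) (T : choiceType) (A E : set T) : R :=
  #|` fset_set (A `&` E)|%fset%:R / #|` fset_set A|%fset%:R.

(* If t_n is uniform in the finite set A n, then f n t_n tends to l in
   probability. *)
Definition uniform_cvg_in_proba (R : realType) (T : choiceType)
    (A : nat -> set T) (f : nat -> T -> R) (l : R) : Prop :=
  forall eps : R, 0 < eps ->
    uniform_proba R (A n) [set t | eps < `|f n t - l|] @[n --> \oo] --> (0 : R).

(* Main.v *)
Require Import Defs.
From HB Require Import structures.
From mathcomp Require Import all_boot all_order all_algebra finmap.
From mathcomp Require Import all_classical all_reals all_analysis.
From mathcomp Require Import zify ring lra.
Import Order.TTheory GRing.Theory Num.Theory.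
Import numFieldNormedType.Exports.
Local Open Scope classical_set_scope.
Local Open Scope ring_scope.

(* The excursion of g is the largest k such that g = a v^{+-k} b with lengths
   adding up.  Let s n be the size of the sphere of radius n.  Every element has
   a unique normal word, and there is a connecting word, independent of g and h
   up to two signs, whose insertion between the normal words of g and h gives
   again a normal word; hence s m * s n <= s (m + n + c), and with
   s (m + n) <= s m * s n this yields exp (n L) <= s n <= exp ((n + c) L), where
   L is the logarithm of the growth rate.  Both tails are then first moment
   estimates.  Counting the decompositions a v^{+-k} b bounds the probability of
   an excursion at least k by a multiple of n exp (- k L).  Conversely a connecting
   word containing v^{k+1} can be inserted at each of the n + 1 places of a normal
   word without v^{k+1}, injectively, so the probability of an excursion at most k
   is bounded by a multiple of exp (k L) / n. *)

(** * Pilings and normal words *)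

Section Words.
Set Implicit Arguments.
Unset Strict Implicit.
Local Open Scope nat_scope.
Variables (V : finType) (e : rel V).
Hypotheses (e_sym : symmetric e) (e_irr : irreflexive e).

Implicit Types (x y z : V) (s t : bool) (l : V * bool) (u w : word V).

Definition word_val w : raag e := \pi_(presented (raag_relators e))%qT w.

Lemma word_val_cat u w : word_val (u ++ w) = (word_val u * word_val w)%g.
Proof.
apply/presentedP; apply: pres_sym.
apply: (@pres_trans _ _ _ (u ++ repr (word_val w))).
  by apply/pres_catr/pres_repr.
by apply/pres_catl/pres_repr.
Qed.

Lemma word_val_nil : word_val [::] = 1%g.
Proof. by []. Qed.

Lemma word_val_rcons w l : word_val (rcons w l) = (word_val w * word_val [:: l])%g.
Proof. by rewrite -cats1 word_val_cat. Qed.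

Lemma word_val_cancel x s : (word_val [:: (x, s)] * word_val [:: (x, ~~ s)])%g = 1%g.
Proof. by rewrite -word_val_cat; apply/presentedP;
  exact: (@pres_cancel _ _ [::] [::]). Qed.

Lemma word_valN x s : word_val [:: (x, ~~ s)] = ((word_val [:: (x, s)])^-1)%g.
Proof. by apply: (mulgI (word_val [:: (x, s)])); rewrite word_val_cancel mulgV. Qed.

Lemma word_val_comm l l' : e l.1 l'.1 ->
  commute (word_val [:: l]) (word_val [:: l']).
Proof.
case: l l' => [x s] [y t] /= exy.
have h : commute (word_val [:: (x, true)]) (word_val [:: (y, true)]).
  have : (word_val [:: (x, true)] * word_val [:: (y, true)] *
    word_val [:: (x, false)] * word_val [:: (y, false)])%g = 1%g.
    rewrite -!word_val_cat /=; apply/presentedP.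
    apply: (@pres_relator _ _ [::]
      [:: (x, true); (y, true); (x, false); (y, false)] [::]).
    by exists x, y.
  rewrite (word_valN x true) (word_valN y true) => h.
  by rewrite /commute -[RHS]mul1g -h !mulgA !mulgVK.
by case: s; case: t; rewrite ?(word_valN _ true);
  do ?[exact: h | apply: commuteV | apply: commute_sym].
Qed.

Lemma raag_word g : exists w, word_val w = g.
Proof. by exists (repr g); exact: reprK. Qed.

Lemma raag_gensP g : raag_gens e g <-> exists l, g = word_val [:: l].
Proof.
split=> [[x [->|->]]|[[x [] ->]]].
- by exists (x, true).
- by exists (x, false); rewrite (word_valN x true).
- by exists x; left.
- by exists x; right; rewrite (word_valN x true).
Qed.

Lemma has_word_sizeP g n : has_word_of_size (raag_gens e) g n <->
  exists2 w, word_val w = g & size w = n.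
Proof.
split=> [[s [Ss <- <-]]|[w <- <-]].
  elim: s Ss => [|a s IH] Ss; first by exists [::]; rewrite // big_nil.
  have /raag_gensP[l al] := Ss a (mem_head _ _).
  case: IH => [b bs|w ws sw]; first by apply: Ss; rewrite inE bs orbT.
  exists (l :: w); last by rewrite /= sw.
  by rewrite -cat1s word_val_cat ws big_cons al.
exists [seq word_val [:: l] | l <- w]; split; last 2 first.
- by rewrite size_map.
- elim: w => [|l w IH]; first by rewrite big_nil.
  by rewrite /= big_cons IH -word_val_cat.
by move=> a /mapP[l _ ->]; apply/raag_gensP; exists l.
Qed.

(* One stack of beads per vertex: the letter (x, s) puts a bead [Some s] on x and
   blank beads [None] on the vertices not commuting with x, so that a sign is
   uppermost exactly when its letter can be moved to the end of the word. *)
Definition piling := V -> seq (option bool).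

Definition empty_piling : piling := fun=> [::].

Definition push (p : piling) l : piling := fun z =>
  if e z l.1 then p z else (if z == l.1 then Some l.2 else None) :: p z.

Definition pop x (p : piling) : piling := fun z =>
  if e z x then p z else behead (p z).

Definition stack_top (p : piling) x : option bool := head None (p x).

(** Right multiplication by a letter: it cancels against its inverse when that one is uppermost, and
    is stacked otherwise. *)
Definition act (p : piling) l : piling :=
  if stack_top p l.1 == Some (~~ l.2) then pop l.1 p else push p l.

Definition pushes := foldl push.

Lemma pushK p l : pop l.1 (push p l) = p.
Proof. by apply: funext => z; rewrite /pop /push; case: (e z l.1). Qed.

Lemma stack_top_push p l z : stack_top (push p l) z =
  if e z l.1 then stack_top p z else if z == l.1 then Some l.2 else None.
Proof. by rewrite /stack_top /push; case: ifP. Qed.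

Lemma stack_top_push_same p l : stack_top (push p l) l.1 = Some l.2.
Proof. by rewrite stack_top_push e_irr eqxx. Qed.

Lemma pushC p l l' : e l.1 l'.1 -> push (push p l) l' = push (push p l') l.
Proof.
move=> ell; apply: funext => z; rewrite /push.
have [->|_] := eqVneq z l.1; first by rewrite ell.
have [->|_] := eqVneq z l'.1; first by rewrite (e_sym _ l.1) ell.
by case: (e z l.1); case: (e z l'.1).
Qed.

Definition reducible p l := stack_top p l.1 == Some (~~ l.2).

(** Each letter is tested against the piling of the letters before it, so that reducedness and
    normality share one recursion. *)
Fixpoint accepts (ok : piling -> V * bool -> bool) p w :=
  if w is l :: w' then ok p l && accepts ok (push p l) w' else true.

Lemma accepts_cat ok p u w :
  accepts ok p (u ++ w) = accepts ok p u && accepts ok (pushes p u) w.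
Proof. by elim: u p => //= l u IH p; rewrite IH andbA. Qed.

Lemma accepts_rcons ok p w l :
  accepts ok p (rcons w l) = accepts ok p w && ok (pushes p w) l.
Proof. by rewrite -cats1 accepts_cat /= andbT. Qed.

Lemma pushes_cat p u w : pushes p (u ++ w) = pushes (pushes p u) w.
Proof. exact: foldl_cat. Qed.

Lemma pushes_rcons p w l : pushes p (rcons w l) = push (pushes p w) l.
Proof. by rewrite -cats1 pushes_cat. Qed.

Definition reduced := accepts (fun p l => ~~ reducible p l).

(** Induction on the last letter [l]. A sign uppermost on [x] after pushing [l] either is that of
    [l] or comes from the prefix; in the latter case [l] commutes with [x], and the letter [(x, s)]
    can be carried past it. *)
Lemma strip w x s : reduced empty_piling w ->
  stack_top (pushes empty_piling w) x = Some s ->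
  exists w', [/\ reduced empty_piling w', ~~ reducible (pushes empty_piling w') (x, s),
    pushes empty_piling w = push (pushes empty_piling w') (x, s),
    word_val w = (word_val w' * word_val [:: (x, s)])%g & size w = (size w').+1].
Proof.
elim/last_ind: w => // w l IH.
rewrite /reduced accepts_rcons pushes_rcons -/reduced => /andP[rw rl].
rewrite stack_top_push; case: ifP => [/= exl tx|_].
  have [w' [rw' nx pw vw sw]] := IH rw tx.
  exists (rcons w' l); rewrite /reduced accepts_rcons -/reduced rw' /= !pushes_rcons.
  have stack_top_eq : stack_top (pushes empty_piling w) l.1 = stack_top (pushes
    empty_piling w') l.1.
    by rewrite pw stack_top_push /= e_sym exl.
  split.
  - by move: rl; rewrite /reducible stack_top_eq.
  - by move: nx; rewrite /reducible /= stack_top_push exl.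
  - by rewrite pw pushC.
  - rewrite !word_val_rcons vw -!mulgA; congr (_ * _)%g.
    exact: (@word_val_comm (x, s) l exl).
  - by rewrite !size_rcons sw.
case: eqP => // -> [ls]; exists w; split=> //.
- by rewrite -ls; move: rl; case: l {ls}.
- by rewrite -ls; case: l {ls rl}.
- by rewrite word_val_rcons -ls; case: l {ls rl}.
- by rewrite size_rcons.
Qed.

(** When the new letter is reducible, [strip] brings its inverse to the end of the prefix, and the
    two cancel. *)
Lemma reduced_word w :
  exists w', [/\ reduced empty_piling w', word_val w' = word_val w & size w' <= size w].
Proof.
elim/last_ind: w => [|w l [w' [rw' vw sw]]]; first by exists [::].
have [lr|lr] := boolP (reducible (pushes empty_piling w') l); last first.
  exists (rcons w' l); rewrite /reduced accepts_rcons -/reduced rw' lr !size_rcons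
    ltnS sw.
  by rewrite !word_val_rcons vw.
have [w2 [rw2 _ _ vw2 sw2]] := strip rw' (eqP lr).
exists w2; split=> //; last by rewrite size_rcons; rewrite sw2 in sw;
  exact: (leq_trans (ltnW sw)).
rewrite word_val_rcons -vw vw2 -mulgA.
have := word_val_cancel l.1 (~~ l.2); rewrite negbK; case: l {lr vw2} => x s /= ->.
by rewrite mulg1.
Qed.

(** On these pilings the action of a letter is invertible; in an arbitrary one, [pop] may remove
    beads that [push] does not put back. *)
Definition valid p := exists2 w, reduced empty_piling w & p = pushes empty_piling w.

Lemma valid_stack_top p x s : valid p -> stack_top p x = Some s ->
  exists2 q, valid q & ~~ reducible q (x, s) /\ p = push q (x, s).
Proof.
case=> w rw -> /(strip rw)[w' [rw' nr pw _ _]].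
by exists (pushes empty_piling w') => //; exists w'.
Qed.

Lemma valid_push p l : valid p -> ~~ reducible p l -> valid (push p l).
Proof.
case=> w rw -> rl; exists (rcons w l); rewrite ?pushes_rcons //.
by rewrite /reduced accepts_rcons -/reduced rw.
Qed.

Lemma act_push p l : ~~ reducible p l -> act p l = push p l.
Proof. by rewrite /act /reducible => /negbTE ->. Qed.

Lemma act_pop q x s : act (push q (x, s)) (x, ~~ s) = q.
Proof. by rewrite /act (stack_top_push_same q (x, s)) /= negbK eqxx (pushK q (x,
  s)). Qed.

Lemma act_cases p l : valid p ->
  (~~ reducible p l /\ act p l = push p l) \/
  exists2 q, valid q & [/\ ~~ reducible q (l.1, ~~ l.2), p = push q (l.1,
    ~~ l.2) & act p l = q].
Proof.
move=> vp; have [lr|lr] := boolP (reducible p l); last by left; rewrite act_push.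
right; have [q vq [nr pq]] := valid_stack_top vp (eqP lr).
exists q => //; split=> //; rewrite pq.
by have := act_pop q l.1 (~~ l.2); rewrite negbK; case: (l).
Qed.

Lemma valid_act p l : valid p -> valid (act p l).
Proof.
move=> vp; have [[nr ->]|[q vq [_ _ ->]]] := act_cases l vp => //.
exact: valid_push.
Qed.

Lemma valid_foldl p w : valid p -> valid (foldl act p w).
Proof. by elim: w p => //= l w IH p vp; exact/IH/valid_act. Qed.

Lemma actK p l : valid p -> act (act p l) (letter_inv l) = p.
Proof.
move=> vp; have [[nr ->]|[q vq [nr -> ->]]] := act_cases l vp.
  by case: l {nr} => x s; exact: act_pop.
exact: act_push.
Qed.

Lemma reducible_comm p l l' : e l.1 l'.1 -> reducible (push p l) l' = reducible p l'.
Proof. by move=> ell; rewrite /reducible stack_top_push e_sym ell. Qed.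

Lemma actC p l l' : valid p -> e l.1 l'.1 -> act (act p l) l' = act (act p l') l.
Proof.
move=> vp ell; have ell' : e l'.1 l.1 by rewrite e_sym.
have [[nr al]|[q vq [nr pq al]]] := act_cases l vp; rewrite al;
  have [[nr' al']|[q' vq' [nr' pq' al']]] := act_cases l' vp; rewrite al'.
- by rewrite !act_push ?reducible_comm // pushC.
- rewrite (@act_push q' l); last by move: nr; rewrite pq' reducible_comm.
  rewrite pq' pushC //.
  by have := act_pop (push q' l) l'.1 (~~ l'.2); rewrite negbK; case: (l').
- rewrite (@act_push q l'); last by move: nr'; rewrite pq reducible_comm.
  rewrite pq pushC //.
  by have := act_pop (push q l') l.1 (~~ l.2); rewrite negbK; case: (l).
(* Both letters cancel: their inverses are both uppermost in [p], which is therefore some [q2] with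
   two commuting letters pushed on it. *)
- have : stack_top q l'.1 = Some (~~ l'.2).
    by rewrite -(stack_top_push_same q' (l'.1, ~~ l'.2)) -pq' pq stack_top_push /= ell'.
  move=> /(valid_stack_top vq)[q2 vq2 [nr2 qq2]].
  have q'E : q' = push q2 (l.1, ~~ l.2).
    by rewrite -(pushK q' (l'.1, ~~ l'.2)) -pq' pq qq2 pushC // (pushK _ (l'.1,
      ~~ l'.2)).
  rewrite qq2 q'E.
  have := act_pop q2 l'.1 (~~ l'.2); have := act_pop q2 l.1 (~~ l.2).
  by rewrite !negbK; case: (l) => ? ? /= ->; case: (l') => ? ? /= ->.
Qed.

(** The group acts on valid pilings: free cancellation is [actK], a commutation relator is [actC]
    followed by [actK]. So the piling reached from the empty one depends only on the value of the
    word. *)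
Lemma pile_pres u w : pres_eq (raag_relators e) u w ->
  forall p, valid p -> foldl act p u = foldl act p w.
Proof.
elim=> {u w} [//|u w _ IH p /IH //|u1 u2 u3 _ IH1 _ IH2 p vp|u w l p vp|u r w].
- by rewrite IH1 // IH2.
- by rewrite !foldl_cat /= actK //; exact: valid_foldl.
case=> x [y [exy ->]] p vp; rewrite !foldl_cat /=; congr foldl.
move: (foldl act p u) (valid_foldl u vp) => {u vp}p vp.
rewrite (@actC p (x, true) (y, true)) //.
rewrite (@actK _ (x, true)); last exact: valid_act.
exact: (@actK _ (y, true)).
Qed.

Lemma reduced_pushes p w : reduced p w -> foldl act p w = pushes p w.
Proof. by elim: w p => //= l w IH p /andP[nr /IH rw]; rewrite act_push. Qed.

Lemma reduced_inj u w : reduced empty_piling u -> reduced empty_piling w ->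
  word_val u = word_val w -> pushes empty_piling u = pushes empty_piling w.
Proof.
move=> ru rw /presentedP uw; rewrite -(reduced_pushes ru) -(reduced_pushes rw).
by apply: pile_pres => //; exists [::].
Qed.

(* Among the letters that can be moved to the end of a reduced word, a normal
   word ends with the one of least rank. *)
Variable rk : V -> nat.
Hypothesis rk_inj : injective rk.

Definition normal_step p l := ~~ reducible p l &&
  [forall z, (e z l.1 && (rk z < rk l.1)) ==> (stack_top p z == None)].

Definition normal_word := accepts normal_step.

Lemma normal_stepP p l : reflect
  (stack_top p l.1 != Some (~~ l.2) /\ forall z,
    e z l.1 -> rk z < rk l.1 -> stack_top p z = None)
  (normal_step p l).
Proof.
apply: (iffP andP) => [[nr /forallP h]|[nr h]]; split=> //.
  by move=> z ez rz; have := h z; rewrite ez rz => /eqP.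
by apply/forallP => z; apply/implyP => /andP[ez rz]; rewrite h.
Qed.

Lemma normal_reduced p w : normal_word p w -> reduced p w.
Proof. by elim: w p => //= l w IH p /andP[/andP[nr _] /IH rw]; apply/andP. Qed.

(** If the last letters lay on different vertices, these would commute and each letter would already
    be uppermost before the other is pushed. The rank condition forbids this for the word ending
    with the larger rank. *)
Lemma normal_pushes_inj u w : normal_word empty_piling u ->
  normal_word empty_piling w ->
  pushes empty_piling u = pushes empty_piling w -> u = w.
Proof.
elim/last_ind: u w => [|u l IH] w.
  elim/last_ind: w => // w l _ _ _;
    rewrite pushes_rcons => /(congr1 (stack_top ^~ l.1)).
  by rewrite stack_top_push_same.
elim/last_ind: w => [_ _|w l' _].
  by rewrite pushes_rcons => /(congr1 (stack_top ^~ l.1)); rewrite stack_top_push_same.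
rewrite /normal_word !accepts_rcons -!/normal_word !pushes_rcons.
move=> /andP[nu /normal_stepP[_ sl]] /andP[nw /normal_stepP[_ sl']] E.
have El : l.1 = l'.1.
  have t1 : stack_top (push (pushes empty_piling u) l) l'.1 = Some l'.2
    by rewrite E stack_top_push_same.
  have t2 : stack_top (push (pushes empty_piling w) l') l.1 = Some l.2
    by rewrite -E stack_top_push_same.
  apply/eqP; apply: contraT => ne; move: t1 t2.
  rewrite !stack_top_push (negbTE ne) eq_sym (negbTE ne).
  case: ifP => // e1 t1; case: ifP => // e2 t2.
  have [r1|r1|/rk_inj r1] := ltngtP (rk l.1) (rk l'.1).
  - by rewrite sl' in t2.
  - by rewrite sl in t1.
  - by rewrite r1 eqxx in ne.
have El2 : l = l'.
  have /(congr1 (stack_top ^~ l.1)) := E.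
  rewrite stack_top_push_same El stack_top_push_same;
    case: l l' {E sl sl'} El => [? ?] [? ?] /= -> [->] //.
have -> : u = w by apply: IH => //; rewrite -(pushK (pushes _ u) l) E El2 pushK.
by rewrite El2.
Qed.

(** The word is built from its end: among the vertices showing a sign, the one of least rank is
    stripped and written last. *)
Lemma reduced_normal w : reduced empty_piling w ->
  exists w', [/\ normal_word empty_piling w',
    pushes empty_piling w' = pushes empty_piling w,
     word_val w' = word_val w & size w' = size w].
Proof.
have [n] := ubnP (size w); elim: n w => // n IH w sw rw.
case/lastP: w sw rw => [|w l] sw rw; first by exists [::].
set w1 := rcons w l in sw rw *.
have tl : stack_top (pushes empty_piling w1) l.1 != None.
  by rewrite /w1 pushes_rcons stack_top_push_same.
case: (@arg_minnP V l.1 (fun x => stack_top (pushes empty_piling w1) x != None) rk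
  tl) => x.
case tx : (stack_top _ x) => [s|//] _ xmin.
have [w2 [rw2 nr pw2 vw2 sw2]] := strip rw tx.
have [|w3 [nw3 pw3 vw3 sw3]] := IH w2 _ rw2; first by rewrite -ltnS -sw2.
exists (rcons w3 (x, s)); split.
- rewrite /normal_word accepts_rcons -/normal_word nw3 pw3 /=; apply/normal_stepP;
  split=> // z /= ez rz.
  apply/eqP; apply: contraTT rz => tz; rewrite -leqNgt.
  by apply: xmin; rewrite pw2 stack_top_push ez.
- by rewrite pushes_rcons pw3 pw2.
- by rewrite word_val_rcons vw3 vw2.
- by rewrite size_rcons sw3 sw2.
Qed.

Lemma normal_inj u w : normal_word empty_piling u -> normal_word empty_piling w ->
  word_val u = word_val w -> u = w.
Proof. by move=> nu nw uw; apply: normal_pushes_inj => //; apply: reduced_inj => //;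
  exact: normal_reduced. Qed.

Local Notation wl := (word_length (raag_gens e)).

Lemma reduced_size u w : reduced empty_piling u -> word_val u = word_val w ->
  size u <= size w.
Proof.
move=> ru uw; have [w' [rw' vw' sw']] := reduced_word w.
have [u2 [nu2 _ vu2 <-]] := reduced_normal ru.
have [w2 [nw2 _ vw2 sw2]] := reduced_normal rw'.
by rewrite (@normal_inj u2 w2) ?sw2 // vu2 vw2 vw'.
Qed.

Lemma word_length_reduced w : reduced empty_piling w -> wl (word_val w) = size w.
Proof.
move=> rw; rewrite /word_length; case: xgetP => [n -> [/has_word_sizeP[u vu <-] mn]|].
  apply/eqP; rewrite eqn_leq (reduced_size rw) // andbT.
  by apply: mn; apply/has_word_sizeP; exists w.
move=> /(_ (size w)); case; split=> [|m /has_word_sizeP[u vu <-]];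
  last exact: reduced_size.
by apply/has_word_sizeP; exists w.
Qed.

Lemma word_length_normal w : normal_word empty_piling w -> wl (word_val w) = size w.
Proof. by move=> /normal_reduced; exact: word_length_reduced. Qed.

Lemma normal_exists g : exists2 w, normal_word empty_piling w & word_val w = g.
Proof.
have [u <-] := raag_word g; have [u' [ru' <- _]] := reduced_word u.
by have [w [nw _ <- _]] := reduced_normal ru'; exists w.
Qed.

Lemma word_length_le_size w : wl (word_val w) <= size w.
Proof. by have [u [ru <- suw]] := reduced_word w; rewrite word_length_reduced. Qed.

End Words.

(** * Connecting normal words *)

Section Connector.
Set Implicit Arguments.
Unset Strict Implicit.
Local Open Scope nat_scope.
Variables (V : finType) (e : rel V).
Hypotheses (e_sym : symmetric e) (e_irr : irreflexive e).

Implicit Types (x z : V) (s t : bool) (l : V * bool) (g h w : word V).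

Local Notation op := (opposite_graph e).
Local Notation push := (push e).
Local Notation pushes := (pushes e).
Local Notation p0 := (@empty_piling V).

(** Pushing does not depend on the beads already present, so the beads of a later word can be
    computed from the empty piling and laid on the earlier ones. *)
Definition over (p' p : piling V) : piling V := fun z => p' z ++ p z.

Lemma push_over p' p l : push (over p' p) l = over (push p' l) p.
Proof. by apply: funext => z; rewrite /push /over; case: ifP. Qed.

Lemma pushes_over w p' p : pushes (over p' p) w = over (pushes p' w) p.
Proof. by elim: w p' => //= l w IH p'; rewrite push_over IH. Qed.

Lemma pushes_empty w p : pushes p w = over (pushes p0 w) p.
Proof. by rewrite -pushes_over. Qed.

Lemma stack_top_over p' p z : stack_top (over p' p) z = if p' z is [::] then
  stack_top p z else stack_top p' z.
Proof. by rewrite /stack_top /over; case: (p' z). Qed.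

Definition positive (q : seq V) : word V := [seq (x, true) | x <- q].

(** Only a letter on [c] can be moved to the end of the word. A neighbour of [c] in the opposite
    graph neither cancels nor commutes with it, so it may always follow. *)
Definition blocked c (p : piling V) := forall z, stack_top p z <> None -> z = c.

Lemma blocked_push c p x s : blocked c p -> op c x -> blocked x (push p (x, s)).
Proof.
move=> bp /andP[cx ncx] z; rewrite stack_top_push /=.
case: ifP => [ez /bp zc|_]; first by rewrite zc (negbTE ncx) in ez.
by case: eqP.
Qed.

Lemma blocked_repeat c p s : blocked c p -> blocked c (push p (c, s)).
Proof.
move=> bp z; rewrite stack_top_push /=.
by case: ifP => [_ /bp //|_]; case: eqP.
Qed.

Variable rk : V -> nat.
Local Notation normal_word := (normal_word e rk).
Local Notation normal_step := (normal_step e rk).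

Lemma normal_cons p l w : normal_word p (l :: w) = normal_step p l &&
  normal_word (push p l) w.
Proof. by []. Qed.

Lemma normal_cat p w w' : normal_word p (w ++ w') = normal_word p w &&
  normal_word (pushes p w) w'.
Proof. exact: accepts_cat. Qed.

(** Forgetting the lower beads only turns some stack tops into [None], which both conditions of
    [normal_step] tolerate. *)
Lemma normal_suffix p w : normal_word p w -> normal_word p0 w.
Proof.
have : p = over p0 p by [].
move: {1 3}p p0 => p1 p' ->; elim: w p' => //= l w IH p' /andP[/normal_stepP[tl lx] nw].
rewrite push_over in nw; apply/andP; split; last exact: IH nw.
apply/normal_stepP; split.
  by move: tl; rewrite stack_top_over /stack_top; case: (p' l.1).
by move=> z ez rz; have := lx z ez rz; rewrite stack_top_over /stack_top; case: (p' z).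
Qed.

Lemma blocked_step c p x s : blocked c p -> op c x -> normal_step p (x, s).
Proof.
move=> bp /andP[cx ncx]; apply/normal_stepP; split=> /= [|z ez _].
  by apply/eqP => h; move: cx; rewrite -(bp x) ?eqxx // h.
apply/eqP; apply: contraTT ez => /eqP /bp ->.
exact: ncx.
Qed.

Lemma blocked_path c p q : blocked c p -> path op c q ->
  normal_word p (positive q) /\ blocked (last c q) (pushes p (positive q)).
Proof.
elim: q c p => //= x q IH c p bp /andP[cx xq].
by rewrite normal_cons (blocked_step true bp cx) /=; apply: IH => //;
  exact: blocked_push cx.
Qed.

Lemma blocked_nseq c p k : blocked c p -> stack_top p c = Some true ->
  normal_word p (nseq k (c, true)) /\ blocked c (pushes p (nseq k (c, true))).
Proof.
elim: k p => //= k IH p bp tp.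
rewrite normal_cons (_ : normal_step p _ = true) /=.
  apply: IH; first exact: blocked_repeat.
  exact: (stack_top_push_same e_irr p (c, true)).
apply/normal_stepP; split; rewrite /= ?tp // => z ez _.
by apply/eqP; apply: contraTT ez => /eqP /bp ->; rewrite e_irr.
Qed.

(* [last None] of a stack is its lowest bead. *)
Lemma normal_over y t p p' h : (forall z,
  stack_top p z <> None -> z = y) -> stack_top p y = Some t ->
  (forall z, rk z <= rk y) ->
  (p' y = [::] -> last None (pushes p' h y) != Some (~~ t)) ->
  normal_word p' h -> normal_word (over p' p) h.
Proof.
move=> bp tp ymax; elim: h p' => //= l h IH p' hp' /andP[/normal_stepP[tl lx] nh].
apply/andP; split; last first.
  by rewrite push_over; apply: IH nh; rewrite {1}/push; case: ifP => // _ /hp'.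
apply/normal_stepP; split.
  rewrite stack_top_over; case pl : (p' l.1) tl => [|b c];
    last by rewrite /stack_top pl.
  (* A letter cancelling against [p] lies on [y] and becomes the lowest bead there; the hypothesis
     on lowest beads excludes its sign. *)
  move=> _; apply/eqP => tpl.
  have ly : l.1 = y by apply: bp; rewrite tpl.
  rewrite ly in pl; have := hp' pl.
  rewrite pushes_empty /over /push ly e_irr eqxx pl last_cat /=.
  by rewrite -ly tpl in tp; case: tp => <-; rewrite negbK eqxx.
move=> z ez rz; rewrite stack_top_over; case pz : (p' z) (lx z ez rz) => [|b c];
  last by [].
(* In [p] only [y] shows a sign, and no rank exceeds that of [y]. *)
move=> _; apply/eqP; apply: contraTT rz => /eqP /bp ->.
by rewrite -leqNgt.
Qed.

End Connector.

(** * Insertion of a connector between arbitrary normal words *)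

Section Insertion.
Set Implicit Arguments.
Unset Strict Implicit.
Local Open Scope nat_scope.
Variables (V : finType) (e : rel V).
Hypotheses (e_sym : symmetric e) (e_irr : irreflexive e).

Implicit Types (x z : V) (s t : bool) (l : V * bool) (g h w : word V).

Local Notation op := (opposite_graph e).
Local Notation push := (push e).
Local Notation pushes := (pushes e).
Local Notation p0 := (@empty_piling V).

Variables (v y : V) (q r : seq V).
Hypotheses (vq : path op v (rcons q y)) (cover : forall z, z \in v :: rcons q y).
Hypotheses (yNq : y \notin v :: q) (yr : path op y (rcons r v)).

(* Preferring the vertices visited first lets the walk follow any normal word:
   what still commutes with the part already walked has not been visited yet. *)
Definition first_visit z := index z (v :: rcons q y).
Local Notation rk := first_visit.
Local Notation normal_word := (normal_word e rk).
Local Notation normal_step := (normal_step e rk).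

Lemma first_visit_inj : injective rk.
Proof. by move=> x z; rewrite /rk => xz;
  rewrite -(nth_index v (cover x)) xz nth_index. Qed.

Lemma first_visit_max z : rk z <= rk y.
Proof.
rewrite /rk -rcons_cons -cats1 [X in _ <= X]index_cat (negbTE yNq) /= eqxx addn0.
have := cover z; rewrite -rcons_cons -cats1 -index_mem size_cat addn1 ltnS.
by [].
Qed.

(** The invariant of the walk: a vertex showing a sign is the current vertex [a] or commutes with
    everything visited. In the second case it is itself unvisited, so its first visit does not
    precede that of [c]. *)
Lemma cover_step d a c q' s p : v :: rcons q y = d ++ a :: c :: q' -> op a c ->
  (forall z, stack_top p z <> None -> z = a \/ forall x, x \in d ++ [:: a] -> e z x) ->
  normal_step p (c, s).
Proof.
move=> wE /andP[ac nac] tp; apply/normal_stepP; split=> /= [|z ez rz].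
  apply/eqP => h; have /tp : stack_top p c <> None by rewrite h.
  case=> [ca|/(_ a)]; first by rewrite ca eqxx in ac.
  by rewrite mem_cat mem_head orbT e_sym (negbTE nac) => /(_ isT).
apply/eqP; apply: contraTT rz => /eqP /tp[za|zd];
  first by rewrite za (negbTE nac) in ez.
rewrite -leqNgt /rk.
have {wE}-> : v :: rcons q y = (d ++ [:: a]) ++ c :: q' by rewrite wE -catA.
move: (d ++ [:: a]) zd => da zd.
have zda : z \notin da by apply: contraPN (e_irr z) => /zd ->.
rewrite (index_cat z) (negbTE zda).
rewrite index_cat; case: ifP => cda;
  first by rewrite (leq_trans (ltnW _) (leq_addr _ _)) ?index_mem.
by rewrite leq_add2l /= eqxx.
Qed.

(** At the end every vertex has been visited and none commutes with itself, so only the last vertex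
    [y] can still show a sign. *)
Lemma cover_path d a q' p : v :: rcons q y = d ++ a :: q' -> path op a q' ->
  (forall z, stack_top p z <> None -> z = a \/ forall x, x \in d ++ [:: a] -> e z x) ->
  normal_word p (positive q') /\ blocked y (pushes p (positive q')).
Proof.
elim: q' d a p => [|c q' IH] d a p wE /= => [_|/andP[ac cq']] tp.
  split=> // z /tp[za|ze].
    by have := congr1 (last v) wE; rewrite /= last_rcons last_cat /= => ->.
  by have := ze z; rewrite -wE cover e_irr => /(_ isT).
rewrite normal_cons (cover_step _ wE ac tp) /=.
apply: (IH (rcons d a) c); rewrite ?cat_rcons // => z.
rewrite stack_top_push /=; case: ifP => [ez /tp[za|ze]|_].
- by case/andP: ac => _; rewrite -za ez.
- right=> x; rewrite mem_cat !inE orbA => /orP[xd|/eqP -> //].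
  by apply: ze; rewrite mem_cat mem_seq1.
- by case: eqP => // ->; left.
Qed.

(* The signs are chosen so that the first letter of the connector does not cancel
   against [g], nor its last letter against [h]. *)
Definition entry_sign g := if stack_top (pushes p0 g) v is Some s then s else true.
Definition exit_sign h := if last None (pushes p0 h y) is Some t then t else true.

(** The first walk blocks the piling at [y]. The walk back ends with a [v] that joins [nseq k] into
    a run of [k.+1] letters. The last walk ends at [y], the vertex of greatest rank, after which any
    normal word may follow once the sign is right. *)
Definition connector s k t : word V :=
  (v, s) :: positive (rcons q y) ++ positive (rcons r v) ++ nseq k (v,
    true) ++ positive q ++ [:: (y, t)].

Lemma normal_connect g k h : normal_word p0 g -> normal_word p0 h ->
  normal_word p0 (g ++ connector (entry_sign g) k (exit_sign h) ++ h).
Proof.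
move=> ng nh; rewrite normal_cat ng /= normal_cons.
set p := pushes p0 g; set s := entry_sign g.
(* The rank of [v] is zero, so only a cancellation could obstruct the first letter. *)
have -> /= : normal_step p (v, s).
  apply/normal_stepP; split=> /=.
    by rewrite /s /entry_sign -/p; case: (stack_top p v) => // b; case: b.
  by move=> z _; rewrite /rk /= eqxx.
have [n1 b1] : normal_word (push p (v, s)) (positive (rcons q y)) /\
    blocked y (pushes (push p (v, s)) (positive (rcons q y))).
  apply: (@cover_path [::] v) => // z; rewrite stack_top_push /=.
  case: ifP => [ez _|_]; first by right=> x; rewrite mem_seq1 => /eqP ->.
  by case: eqP => // ->; left.
rewrite -!catA normal_cat n1 /=.
set p1 := pushes _ _ in b1 *.
have [n2 b2] := blocked_path rk b1 yr.
rewrite normal_cat n2 /=; rewrite last_rcons in b2.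
have t2 : stack_top (pushes p1 (positive (rcons r v))) v = Some true.
  by rewrite /positive map_rcons pushes_rcons;
    exact: (stack_top_push_same e_irr _ (v, true)).
set p2 := pushes _ _ in b2 t2 *.
have [n3 b3] := blocked_nseq e_irr rk k b2 t2.
rewrite normal_cat n3 /=.
set p3 := pushes _ _ in b3 *.
move: vq; rewrite rcons_path => /andP[vq' qy].
have [n4 b4] := blocked_path rk b3 vq'.
rewrite normal_cat n4 /=.
set p4 := pushes _ _ in b4 *; set t := exit_sign h.
rewrite normal_cons (blocked_step rk t b4 qy) /=.
rewrite [push p4 _](_ : _ = over p0 (push p4 (y, t))) //.
apply: (normal_over e_irr (y := y) (t := t)) => //.
- exact: blocked_push qy.
- exact: (stack_top_push_same e_irr _ (y, t)).
- exact: first_visit_max.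
- by move=> _; rewrite /t /exit_sign; case: (last _ _) => //; case.
Qed.

End Insertion.

(** * Excursions *)

Section Suprema.
Set Implicit Arguments.
Unset Strict Implicit.
Variable R : realType.

Lemma sup_le_nneg (A : set R) M : 0 <= M -> (forall x, A x -> x <= M) -> sup A <= M.
Proof.
move=> M0 AM; have [->|A0] := eqVneq A set0; first by rewrite sup0.
by apply: ge_sup; [exact/set0P|move=> x /AM].
Qed.

Lemma sup_ge_bounded (A : set R) M x : (forall z, A z -> z <= M) -> A x -> x <= sup A.
Proof. by move=> AM; apply: ub_le_sup; exists M => z /AM. Qed.

End Suprema.

(** * Runs in cosets of the vertex group along geodesics *)

Section VertexExcursion.
Set Implicit Arguments.
Unset Strict Implicit.
Local Open Scope nat_scope.
Variables (V : finType) (e : rel V).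
Hypotheses (e_sym : symmetric e) (e_irr : irreflexive e).

Implicit Types (s : bool) (g h a b t : raag e) (w : word V).

Local Notation wl := (word_length (raag_gens e)).

Lemma geodesic_word g : exists2 w, word_val e w = g & size w = wl g.
Proof.
have [w nw <-] := normal_exists e_sym e_irr (fun x => enum_rank x) g.
by exists w; rewrite ?(word_length_normal e_sym e_irr _ nw) //;
  move=> x z /ord_inj/enum_rank_inj.
Qed.

Lemma word_length_val_le w : wl (word_val e w) <= size w.
Proof.
by apply: (word_length_le_size e_sym e_irr (rk :=
  fun x => enum_rank x)) => x z /ord_inj/enum_rank_inj.
Qed.

Lemma word_lengthM g h : wl (g * h)%g <= wl g + wl h.
Proof.
have [u <- <-] := geodesic_word g; have [w <- <-] := geodesic_word h.
by rewrite -word_val_cat -size_cat; exact: word_length_val_le.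
Qed.

Lemma word_val_inv w : word_val e (word_inv w) = ((word_val e w)^-1)%g.
Proof.
apply: (mulgI (word_val e w)); rewrite mulgV -word_val_cat.
by apply/presentedP; exact: pres_mulwV.
Qed.

Lemma word_lengthV g : wl (g^-1)%g = wl g.
Proof.
suff le h : wl (h^-1)%g <= wl h by apply/eqP; rewrite eqn_leq le -{1}(invgK g) le.
have [u <- <-] := geodesic_word h.
by rewrite -word_val_inv (leq_trans (word_length_val_le _)) // /word_inv size_rev
  size_map.
Qed.

Lemma word_length1 : wl 1%g = 0.
Proof. by apply/eqP; rewrite -leqn0; exact: (word_length_val_le [::]). Qed.

Variable v : V.
Local Notation H := (cyclic_subgroup (raag_vertex e v)).

Definition vertex_pow s k : raag e := word_val e (nseq k (v, s)).

Lemma vertex_powD s k m : vertex_pow s (k + m) = (vertex_pow s k * vertex_pow s m)%g.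
Proof. by rewrite /vertex_pow nseqD word_val_cat. Qed.

Lemma vertex_powS s k : vertex_pow s k.+1 = (word_val e [:: (v, s)] * vertex_pow s k)%g.
Proof. exact: (vertex_powD s 1 k). Qed.

Lemma vertex_powN s k : vertex_pow (~~ s) k = ((vertex_pow s k)^-1)%g.
Proof.
by rewrite /vertex_pow -word_val_inv /word_inv map_nseq rev_nseq.
Qed.

Lemma vertex_powE k : vertex_pow true k = (raag_vertex e v ^+ k)%g.
Proof. by elim: k => // k IH; rewrite expgS -IH vertex_powS. Qed.

Lemma cyclicP h : H h <-> exists s k, h = vertex_pow s k.
Proof.
split=> [[k [->|->]]|[[] [k ->]]].
- by exists true, k; rewrite vertex_powE.
- by exists false, k; rewrite (vertex_powN true) vertex_powE.
- by exists k; left; rewrite vertex_powE.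
- by exists k; right; rewrite (vertex_powN true) vertex_powE.
Qed.

Lemma cyclicV h : H h -> H (h^-1)%g.
Proof.
by move=> /cyclicP[s [k ->]]; apply/cyclicP; exists (~~ s), k; rewrite vertex_powN.
Qed.

Lemma cyclicM g h : H g -> H h -> H (g * h)%g.
Proof.
move=> /cyclicP[s [k ->]]; elim: k h => [|k IH] h Hh.
  by rewrite /vertex_pow /= word_val_nil mul1g.
rewrite -addn1 vertex_powD -mulgA; apply: IH.
move: Hh => /cyclicP[t [m ->]]; apply/cyclicP.
have [<-|st] := eqVneq s t; first by exists s, m.+1; rewrite -vertex_powD.
have {st}-> : s = ~~ t by case: s t st => [] [].
case: m => [|m]; first by exists (~~ t), 1%N; rewrite /vertex_pow /= word_val_nil mulg1.
exists t, m; rewrite (vertex_powS t m) mulgA /vertex_pow /=.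
by rewrite word_valN mulVg mul1g.
Qed.

Lemma word_length_vertex_pow s k : wl (vertex_pow s k) = k.
Proof.
rewrite /vertex_pow (word_length_reduced e_sym e_irr (rk :=
  fun x => enum_rank x)) ?size_nseq //.
  by move=> x z /ord_inj/enum_rank_inj.
suff : forall p : piling V, stack_top p v <> Some (~~ s) -> reduced e p (nseq k (v,
  s)) by apply.
elim: k => //= k IH p tp; apply/andP; split; first exact/eqP.
by apply: IH; rewrite (stack_top_push_same e_irr p (v, s)) /=; case: s {tp}.
Qed.

(** Lengths adding up means that some geodesic from the identity to [g] follows a coset of [H] along
    [k] edges. *)
Definition long_run g k := exists s a b,
  g = (a * vertex_pow s k * b)%g /\ wl g = wl a + k + wl b.

Lemma long_run_le g k : long_run g k -> k <= wl g.
Proof. by case=> s [a [b [_ ->]]]; lia. Qed.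

Lemma long_run_mono g k m : m <= k -> long_run g k -> long_run g m.
Proof.
move=> mk [s [a [b [gE gl]]]].
exists s, a, (vertex_pow s (k - m) * b)%g; split.
  by rewrite !mulgA -(mulgA a) -vertex_powD subnKC.
(* By triangle inequalities the new lengths add up to at least [wl g] and to at most the old sum,
   which is [wl g]. *)
have h1 := word_lengthM (vertex_pow s (k - m)) b; rewrite word_length_vertex_pow in h1.
have h2 := word_lengthM (a * vertex_pow s m)%g (vertex_pow s (k - m) * b)%g.
rewrite -mulgA (mulgA (vertex_pow s m)) -vertex_powD subnKC // mulgA -gE in h2.
have := word_lengthM a (vertex_pow s m); rewrite word_length_vertex_pow; lia.
Qed.

Local Notation edge := (cayley_edge (raag_gens e)).

Lemma path_length a p : path edge a p -> wl (a^-1 * last a p)%g <= size p.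
Proof.
elim: p a => [|b p IH] a /=; first by rewrite mulVg word_length1.
move=> /andP[/asboolP/raag_gensP[l ab] /IH bp].
have -> : (a^-1 * last b p = (a^-1 * b) * (b^-1 * last b p))%g.
  by rewrite mulgA mulgK.
rewrite (leq_trans (word_lengthM _ _)) // -add1n leq_add // ab.
exact: word_length_val_le.
Qed.

Lemma mem_cons_split (T : eqType) (x x0 : T) p : x \in x0 :: p ->
  exists p1 p2, p = p1 ++ p2 /\ last x0 p1 = x.
Proof. by case/splitPl => p1 p2 px; exists p1, p2. Qed.

(** The three subpaths cut out by two vertices have total size [wl g] and bound the three distances
    from above; the triangle inequality gives the converse. The alternative is the order of the
    vertices on the path. *)
Lemma geodesic_between g p a b : geodesic (raag_gens e) 1%g g p ->
    a \in 1%g :: p -> b \in 1%g :: p ->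
  let d c c' := wl g = wl c + wl (c^-1 * c')%g + wl (c'^-1 * g)%g in d a b \/ d b a.
Proof.
move=> geo.
suff h c c' p1 p2 : p = p1 ++ p2 -> last 1%g p1 = c -> c' \in c :: p2 ->
    wl g = wl c + wl (c^-1 * c')%g + wl (c'^-1 * g)%g.
  move=> /mem_cons_split[p1 [p2 [E pa]]] bp.
  have [b2|] := boolP (b \in a :: p2); first by left; apply: (h _ _ p1 p2).
  rewrite inE negb_or => /andP[_ /negbTE b2].
  move: bp; rewrite E -cat_cons mem_cat b2 orbF.
  move=> /mem_cons_split[p3 [p4 [E1 pb]]]; right.
  apply: (h _ _ p3 (p4 ++ p2)) => //; first by rewrite E E1 catA.
  by rewrite -cat_cons mem_cat -pa E1 last_cat pb mem_last.
case: geo => pg lg sg pE c1 /mem_cons_split[p3 [p4 [E c2]]].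
move: pg lg sg; rewrite pE E !cat_path !last_cat c1 c2 !size_cat.
move=> /and3P[/path_length h1 /path_length h2 /path_length h3] lg.
rewrite /word_dist invg1 mul1g => sg.
rewrite c1 invg1 mul1g in h1; rewrite c2 in h2; rewrite lg in h3.
have h4 := word_lengthM c (c^-1 * c')%g; rewrite mulVKg in h4.
have := word_lengthM c' (c'^-1 * g)%g; rewrite mulVKg.
lia.
Qed.

Lemma coset_dist a b (t : raag e) : left_coset H t a -> left_coset H t b ->
  H (a^-1 * b)%g.
Proof.
move=> [h Hh <-] [h' Hh' <-]; rewrite invgM -mulgA mulKg.
by apply: cyclicM => //; exact: cyclicV.
Qed.

Lemma geodesic_coset_long_run g p a b t : geodesic (raag_gens e) 1%g g p ->
    a \in 1%g :: p -> b \in 1%g :: p -> left_coset H t a -> left_coset H t b ->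
  long_run g (word_dist (raag_gens e) a b).
Proof.
move=> geo.
suff h c c' : left_coset H t c -> left_coset H t c' ->
    wl g = wl c + wl (c^-1 * c')%g + wl (c'^-1 * g)%g ->
    long_run g (word_dist (raag_gens e) c c').
  move=> ap bp ta tb; have [d|d] := geodesic_between geo ap bp; first exact: h.
  by rewrite /word_dist -word_lengthV invgM invgK; exact: h.
move=> tc tc' d; have /cyclicP[s [k ck]] := coset_dist tc tc'.
exists s, c, (c'^-1 * g)%g; split; last exact: d.
by rewrite /word_dist {1}ck word_length_vertex_pow -ck mulVKg mulVKg.
Qed.

Definition vertices w : seq (raag e) :=
  scanl (fun g l => g * word_val e [:: l])%g 1%g w.

Lemma foldl_word_val a w :
  foldl (fun g l => g * word_val e [:: l])%g a w = (a * word_val e w)%g.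
Proof.
elim: w a => [|l w IH] a /=; first by rewrite word_val_nil mulg1.
by rewrite IH -mulgA -word_val_cat.
Qed.

Lemma last_vertices w : last 1%g (vertices w) = word_val e w.
Proof.
rewrite -[RHS]mul1g -foldl_word_val /vertices.
by elim: w 1%g => //= l w IH a; exact: IH.
Qed.

Lemma geodesic_vertices w : wl (word_val e w) = size w ->
  geodesic (raag_gens e) 1%g (word_val e w) (vertices w).
Proof.
move=> lw; split.
- rewrite /vertices; elim: w 1%g {lw} => //= l w IH a; rewrite IH andbT.
  by apply/asboolP/raag_gensP; exists l; rewrite mulKg.
- exact: last_vertices.
- by rewrite size_scanl /word_dist invg1 mul1g lw.
Qed.

Lemma mem_vertices u w : word_val e u \in 1%g :: vertices (u ++ w).
Proof. by rewrite /vertices scanl_cat -last_vertices -cat_cons mem_cat mem_last. Qed.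

(** Geodesic words for [a] and [b] around the run spell a word of length [wl g]; its geodesic meets
    the coset of [a] at both ends of the run. *)
Lemma long_run_geodesic g k : long_run g k ->
  exists p a b t, [/\ geodesic (raag_gens e) 1%g g p,
    a \in 1%g :: p /\ left_coset H t a, b \in 1%g :: p /\ left_coset H t b &
    word_dist (raag_gens e) a b = k].
Proof.
case=> s [a [b [gE gl]]].
have [wa va sa] := geodesic_word a; have [wb vb sb] := geodesic_word b.
pose w := wa ++ nseq k (v, s) ++ wb.
have vw : word_val e w = g by rewrite !word_val_cat va vb gE mulgA.
exists (vertices w), a, (a * vertex_pow s k)%g, a; split.
- by rewrite -vw; apply: geodesic_vertices;
  rewrite vw gl !size_cat size_nseq sa sb addnA.
- split; first by rewrite -va mem_vertices.
  by exists 1%g; rewrite ?mulg1 //; apply/cyclicP; exists true, 0%N.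
- split; first by rewrite -va -word_val_cat /w catA mem_vertices.
  by exists (vertex_pow s k) => //; apply/cyclicP; exists s, k.
- by rewrite /word_dist mulKg word_length_vertex_pow.
Qed.

Variable R : realType.
Local Open Scope ring_scope.

Local Notation exc := (excursion R (raag_gens e) H).

Lemma geodesic_diam_le g p t M : geodesic (raag_gens e) 1%g g p -> 0 <= M ->
    (forall k, long_run g k -> k%:R <= M) ->
  diam R (raag_gens e) ([set` 1%g :: p] `&` left_coset H t) <= M.
Proof.
move=> geo M0 hM; apply: sup_le_nneg => // _ [[a b] /= [[pa ta] [pb tb]] <-].
by apply: hM; exact: (geodesic_coset_long_run geo pa pb ta tb).
Qed.

Lemma path_excursion_le g p M : geodesic (raag_gens e) 1%g g p -> 0 <= M ->
    (forall k, long_run g k -> k%:R <= M) ->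
  path_excursion R (raag_gens e) H [set` 1%g :: p] <= M.
Proof.
move=> geo M0 hM; apply: sup_le_nneg => // _ [t _ <-].
exact: (geodesic_diam_le t geo).
Qed.

Lemma excursion_le g (M : R) : 0 <= M -> (forall k, long_run g k -> k%:R <= M) ->
  exc g <= M.
Proof.
move=> M0 hM; apply: sup_le_nneg => // _ [p geo <-].
exact: path_excursion_le geo _ hM.
Qed.

Lemma excursion_ge g k : long_run g k -> k%:R <= exc g.
Proof.
move=> gk; have [p [a [b [t [geo [pa ta] [pb tb] <-]]]]] := long_run_geodesic gk.
have M0 : 0 <= (wl g)%:R :> R by [].
have hM k' : long_run g k' -> k'%:R <= (wl g)%:R :> R.
  by move=> /long_run_le; rewrite ler_nat.
apply: (@le_trans _ _ (diam R (raag_gens e) ([set` 1%g :: p] `&` left_coset H t))).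
  (* Each of the three suprema dominates its members only if its set is bounded; no run is longer
     than [wl g]. *)
  apply: (sup_ge_bounded (M := (wl g)%:R)); last by exists (a, b).
  move=> _ [[c c'] /= [[pc tc] [pc' tc']] <-].
  by apply: hM; exact: (geodesic_coset_long_run geo pc pc' tc tc').
apply: (@le_trans _ _ (path_excursion R (raag_gens e) H [set` 1%g :: p])).
  apply: (sup_ge_bounded (M := (wl g)%:R)); last by exists t.
  by move=> _ [t' _ <-]; exact: (geodesic_diam_le t' geo).
apply: (sup_ge_bounded (M := (wl g)%:R)); last by exists p.
by move=> _ [p' geo' <-]; exact: path_excursion_le geo' _ hM.
Qed.

End VertexExcursion.

(** * Counting spheres *)

Section FiniteCard.
Set Implicit Arguments.
Unset Strict Implicit.
Local Open Scope nat_scope.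
Implicit Types T U : choiceType.

Definition setcard T (A : set T) : nat := #|` fset_set A|%fset.

Lemma setcard_sub T (A B : set T) : finite_set B -> A `<=` B -> setcard A <= setcard B.
Proof.
move=> fB AB; apply: fsubset_leq_card; rewrite -fset_set_sub //.
exact: sub_finite_set fB.
Qed.

Lemma setcard_image T U (f : T -> U) A : finite_set A -> setcard (f @` A) <= setcard A.
Proof.
by move=> fA; rewrite /setcard fset_set_image // (leq_trans (leq_imfset_card _ _ _))
  // card_finset.
Qed.

Lemma setcard_inj T U (f : T -> U) A B : finite_set A -> finite_set B ->
  (forall x, A x -> B (f x)) -> (forall x z, A x -> A z -> f x = f z -> x = z) ->
  setcard A <= setcard B.
Proof.
move=> fA fB AB fi; apply: (@leq_trans (setcard (f @` A))); last first.
  by apply: setcard_sub => // _ [x /AB ? <-].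
rewrite /setcard fset_set_image // card_in_imfset //= => x z.
by rewrite !in_fset_set // !inE; exact: fi.
Qed.

Lemma setcardX T U (A : set T) (B : set U) : finite_set A -> finite_set B ->
  setcard (A `*` B) = setcard A * setcard B.
Proof.
move=> fA fB; rewrite /setcard fset_setX // -(size_allpairs pair) /=.
apply/perm_size/uniq_perm => [||[x z]]; first exact: fset_uniq.
  by apply: allpairs_uniq; rewrite ?fset_uniq // => -[? ?] [? ?].
by rewrite in_fsetM; apply/andP/allpairsP => /= [[? ?]|[[? ?] [? ? [-> ->]]] //];
  exists (x, z).
Qed.

Lemma setcardU T (A B : set T) : finite_set A -> finite_set B ->
  setcard (A `|` B) <= setcard A + setcard B.
Proof. by move=> fA fB; rewrite /setcard fset_setU //; exact: leq_card_fsetU. Qed.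

Lemma setcard_exists T (P : nat -> set T) n : (forall i, i <= n -> finite_set (P i)) ->
  finite_set [set x | exists2 i, i <= n & P i x] /\
  setcard [set x | exists2 i, i <= n & P i x] <= \sum_(i < n.+1) setcard (P i).
Proof.
elim: n => [|n IH] fP.
  have -> : [set x | exists2 i, i <= 0 & P i x] = P 0.
    by apply/seteqP; split=> x /= => [[[|//] _ //]|]; exists 0.
  by split; [exact: fP|rewrite big_ord_recl big_ord0 addn0].
have -> : [set x | exists2 i, i <= n.+1 & P i x] =
    [set x | exists2 i, i <= n & P i x] `|` P n.+1.
  apply/seteqP; split=> x /=.
    case=> i; rewrite leq_eqVlt => /orP[/eqP ->|]; first by right.
    by rewrite ltnS => ? ?; left; exists i.
  by case=> [[i /leqW ? ?]|?]; [exists i|exists n.+1].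
have [fQ cQ] : _ /\ _ := IH (fun i ni => fP i (leqW ni)).
have fS := fP n.+1 (leqnn _).
split; first by rewrite finite_setU.
by rewrite big_ord_recr /= (leq_trans (setcardU _ _)) // leq_add2r.
Qed.

Lemma setcard_II n : setcard `I_n = n.
Proof. exact: card_fset_set. Qed.

End FiniteCard.

(** * Inequalities between sphere sizes *)

Section SphereCounting.
Set Implicit Arguments.
Unset Strict Implicit.
Local Open Scope nat_scope.
Variables (V : finType) (e : rel V).
Hypotheses (e_sym : symmetric e) (e_irr : irreflexive e).

Implicit Types (s t : bool) (g h a b : raag e) (w : word V).

Local Notation wl := (word_length (raag_gens e)).
Local Notation sphere := (word_sphere (raag_gens e)).
Local Notation op := (opposite_graph e).
Local Notation p0 := (@empty_piling V).

Definition sphere_size n := setcard (sphere n).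

Lemma finite_words n : finite_set [set w : word V | size w = n].
Proof.
apply: (@sub_finite_set _ _ ((fun t : n.-tuple (V * bool) => tval t) @` setT)).
  by move=> w /eqP wn; exists (Tuple wn).
exact/finite_image/finite_finset.
Qed.

Lemma finite_sphere n : finite_set (sphere n).
Proof.
apply: (@sub_finite_set _ _ (word_val e @` [set w : word V | size w = n])).
  by move=> g gn; have [w wg sw] := geodesic_word e_sym e_irr g; exists w => //;
    rewrite /= sw.
exact/finite_image/finite_words.
Qed.

(** A geodesic word is cut after [m] letters; were a piece not geodesic, the whole would be
    shorter. *)
Lemma sphere_size_sub m n : sphere_size (m + n) <= sphere_size m * sphere_size n.
Proof.
have fmn : finite_set (sphere m `*` sphere n) by apply: finite_setX;
  exact: finite_sphere.
rewrite -setcardX; try exact: finite_sphere.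
apply: leq_trans (setcard_image (fun p => p.1 * p.2)%g fmn).
apply: setcard_sub; first exact: finite_image.
move=> g gmn; have [w wg sw] := geodesic_word e_sym e_irr g.
rewrite gmn in sw.
exists (word_val e (take m w), word_val e (drop m w)); last first.
  by rewrite -word_val_cat cat_take_drop.
have h1 := word_length_val_le e_sym e_irr (take m w).
have h2 := word_length_val_le e_sym e_irr (drop m w).
have := word_lengthM e_sym e_irr (word_val e (take m w)) (word_val e (drop m w)).
rewrite -word_val_cat cat_take_drop wg gmn => h3.
move: h1 h2; rewrite size_drop size_takel sw ?leq_addr // addKn => h1 h2.
by split; rewrite /word_sphere /=; lia.
Qed.

Lemma word_ball_bounds n : finite_set (word_ball (raag_gens e) n) /\
  sphere_size n <= setcard (word_ball (raag_gens e) n) <= \sum_(i < n.+1) sphere_size i.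
Proof.
have -> : word_ball (raag_gens e) n = [set g | exists2 i, i <= n & sphere i g].
  apply/seteqP; split=> g => [gn|[i ni gi]]; first by exists (wl g).
  by rewrite /word_ball /= gi.
have [fB cB] := @setcard_exists _ sphere n (fun i _ => finite_sphere i).
by split=> //; rewrite cB andbT; apply: setcard_sub => // g gn; exists n.
Qed.

Lemma sphere_size1 (v : V) : 1 < sphere_size 1.
Proof.
rewrite -{1}(setcard_II 2).
pose f i : raag e := vertex_pow e v (odd i) 1.
apply: (setcard_inj (f := f)) => [|||i j].
- exact: finite_II.
- exact: finite_sphere.
- by move=> i _; exact: word_length_vertex_pow.
(* If [v] equalled its inverse, its square, of length two, would be trivial. *)
have ne : f 0 <> f 1.
  move=> f01; have := word_length_vertex_pow e_sym e_irr v true 2.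
  by rewrite (vertex_powD _ _ _ 1 1) -/(f 1) -{1}f01 /f /= (vertex_powN _ _ true)
    mulVg word_length1.
rewrite /=; case: i => [|[|i]] //; case: j => [|[|j]] // _ _.
by move=> f10; case: (ne (esym f10)).
Qed.

Variable v : V.
Local Notation vpow := (vertex_pow e v).
Local Notation long_run := (@long_run V e v).

(** A union bound in which [i] is the length of the part before the run and the factor 2 counts the
    signs. *)
Lemma card_long_run n k : setcard (sphere n `&` [set g | long_run g k]) <=
  2 * \sum_(i < (n - k).+1) sphere_size i * sphere_size (n - k - i).
Proof.
pose f s (p : raag e * raag e) : raag e := (p.1 * vpow s k * p.2)%g.
pose P i : set (raag e) := f true @` (sphere i `*` sphere (n - k - i)) `|`
  f false @` (sphere i `*` sphere (n - k - i)).
have fX i : finite_set (sphere i `*` sphere (n - k - i)).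
  by apply: finite_setX; exact: finite_sphere.
have fP i : i <= n - k -> finite_set (P i).
  by move=> _; rewrite finite_setU; split; exact: finite_image.
have [fQ cQ] := setcard_exists fP.
apply: (@leq_trans (setcard [set x | exists2 i, i <= n - k & P i x])).
  apply: setcard_sub => // g [/= gn [s [a [b [gE gl]]]]].
  rewrite gn in gl; exists (wl a); first by lia.
  have ab : (sphere (wl a) `*` sphere (n - k - wl a)) (a, b).
    by split=> //=; rewrite /word_sphere /=; lia.
  by rewrite gE; case: (s); [left|right]; exists (a, b).
apply: leq_trans cQ _; rewrite big_distrr /=; apply: leq_sum => i _.
rewrite (leq_trans (setcardU _ _)); try exact: finite_image.
  by [].
rewrite mul2n -addnn -setcardX; try exact: finite_sphere.
by apply: leq_add; exact: setcard_image.
Qed.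

Variables (y : V) (q r : seq V).
Hypotheses (vq : path op v (rcons q y)) (cover : forall z, z \in v :: rcons q y).
Hypotheses (yNq : y \notin v :: q) (yr : path op y (rcons r v)).

Local Notation rk := (first_visit v y q).
Local Notation normal_word := (normal_word e rk p0).

Definition normal_form g : word V := s2val (cid2 (normal_exists e_sym e_irr rk g)).

Lemma normal_form_normal g : normal_word (normal_form g).
Proof. by rewrite /normal_form; case: cid2. Qed.

Lemma normal_formK g : word_val e (normal_form g) = g.
Proof. by rewrite /normal_form; case: cid2. Qed.

Lemma word_valK w : normal_word w -> normal_form (word_val e w) = w.
Proof.
move=> nw; apply: (normal_inj e_sym e_irr (first_visit_inj cover)) => //.
  exact: normal_form_normal.
by rewrite normal_formK.
Qed.

Lemma size_normal_form g : size (normal_form g) = wl g.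
Proof.
rewrite -{2}(normal_formK g) (word_length_normal e_sym e_irr (first_visit_inj cover))
  //.
exact: normal_form_normal.
Qed.

Lemma word_length_val_normal w : normal_word w -> wl (word_val e w) = size w.
Proof. exact: (word_length_normal e_sym e_irr (first_visit_inj cover)). Qed.

Definition connect_words w k w' : word V :=
  w ++ connector v y q r (entry_sign e v w) k (exit_sign e y w') ++ w'.

(** The four extra letters are the ends [v], [y], [v], [y] of the walks; the parameter [k] of a
    connector comes on top. *)
Definition connector_size := (size q + size q + size r).+4.

Lemma size_connector s k t : size (connector v y q r s k t) = connector_size + k.
Proof.
rewrite /connector_size /= !size_cat /positive !size_map !size_rcons size_nseq /=; lia.
Qed.

Lemma normal_connect_words w k w' : normal_word w -> normal_word w' ->
  normal_word (connect_words w k w').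
Proof. exact: normal_connect. Qed.

(** The signs of the connector depend on the two words but its size does not, so both words can be
    read off the result by position. *)
Lemma sphere_size_super m n :
  sphere_size m * sphere_size n <= sphere_size (m + n + connector_size).
Proof.
rewrite -setcardX; try exact: finite_sphere.
pose F (p : raag e * raag e) := connect_words (normal_form p.1) 0 (normal_form p.2).
have nF p : normal_word (F p) by apply: normal_connect_words; exact: normal_form_normal.
apply: (setcard_inj (f := fun p => word_val e (F p))).
- by apply: finite_setX; exact: finite_sphere.
- exact: finite_sphere.
- move=> [g h] [/= gm hn]; rewrite /word_sphere /= word_length_val_normal //.
  by rewrite !size_cat size_connector !size_normal_form gm hn; lia.
- move=> [g h] [g' h'] [/= gm hn] [/= gm' hn'] /(congr1 normal_form).
  rewrite !word_valK // /F /connect_words => /eqP.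
  rewrite eqseq_cat ?size_normal_form ?gm ?gm' // eqseq_cat ?size_connector //.
  move=> /and3P[/eqP gg' _ /eqP hh'].
  by rewrite -(normal_formK g) gg' normal_formK -(normal_formK h) hh' normal_formK.
Qed.

(** The default letter differs from [(v, true)], so a window reaching past the end of the word is
    never a run. Only positive runs are excluded, as the inserted one is positive. *)
Definition run_free k w := forall j, exists2 m, m <= k & nth (v,
  false) w (j + m) != (v, true).

Lemma run_long_run k w : normal_word w -> ~ run_free k w ->
  long_run (word_val e w) k.+1.
Proof.
move=> nw /existsNP[j hj].
have hj' m : m <= k -> nth (v, false) w (j + m) = (v, true).
  by move=> mk; apply/eqP; apply: contrapT => h; apply: hj; exists m => //; exact/negP.
have jk : j + k < size w.
  by rewrite ltnNge; apply/negP => sw; have := hj' k (leqnn k); rewrite nth_default.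
have wE : w = take j w ++ nseq k.+1 (v, true) ++ drop (j + k.+1) w.
  rewrite -{1}(cat_take_drop j w); congr cat.
  rewrite -{1}(cat_take_drop k.+1 (drop j w)) drop_drop (addnC k.+1); congr cat.
  have sz : size (take k.+1 (drop j w)) = k.+1 by rewrite size_takel // size_drop; lia.
  apply: (@eq_from_nth _ (v, false)); rewrite ?size_nseq // => i; rewrite sz => ik.
  by rewrite nth_take // nth_drop nth_nseq ik hj'.
exists true, (word_val e (take j w)), (word_val e (drop (j + k.+1) w)); split.
  by rewrite {1}wE !word_val_cat mulgA.
have n1 : normal_word (take j w) by move: nw; rewrite {1}wE normal_cat => /andP[].
have n2 : normal_word (drop (j + k.+1) w).
  by move: nw; rewrite {1}wE catA normal_cat => /andP[_ /normal_suffix].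
by rewrite !word_length_val_normal // {1}wE !size_cat size_nseq addnA.
Qed.

Lemma connect_wordsE w k w' : connect_words w k w' =
  (w ++ (v, entry_sign e v w) :: positive (rcons q y ++ r)) ++ nseq k.+1 (v, true) ++
  (positive q ++ [:: (y, exit_sign e y w')]) ++ w'.
Proof.
rewrite /connect_words /connector /positive -!cat_cons -!catA; congr (_ ++ _).
by rewrite !cat_cons; congr cons; rewrite map_cat -!catA !map_rcons !cat_rcons.
Qed.

(* An occurrence of [v ^ k.+1] to the right of the inserted one would have to
   contain the first letter after the inserted run or the final [y] of the
   connector, or lie in the run-free word [a2]. *)
Lemma connect_words_size k (a1 a2 b1 b2 : word V) : size q <= k -> run_free k a2 ->
  connect_words a1 k a2 = connect_words b1 k b2 -> size b1 <= size a1.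
Proof.
move=> qk fa2; rewrite !connect_wordsE.
set A := a1 ++ _; set B := b1 ++ _; set tl := _ ++ a2; set tl' := _ ++ b2 => E.
rewrite leqNgt; apply/negP => ab.
have AB : size B - size A = size b1 - size a1.
  by rewrite !size_cat /= !size_map; lia.
have run i : size B <= size A + k.+1 + i <= size B + k -> nth (v, false) tl i = (v,
  true).
  move=> /andP[iB Bi].
  have -> : nth (v, false) tl i =
      nth (v, false) (A ++ nseq k.+1 (v, true) ++ tl) (size A + k.+1 + i).
    by rewrite catA nth_cat size_cat size_nseq ltnNge leq_addr /= addKn.
  rewrite E nth_cat ifN -?leqNgt // nth_cat size_nseq nth_nseq.
  by rewrite (_ : (_ < k.+1) = true) //; lia.
move: AB run; move: (size A) (size B) => sA sB AB run.
have h1 : sB <= sA + k.+1 -> False.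
  move=> BA; have : nth (v, false) tl 0 = (v, true) by apply: run; lia.
  rewrite /tl -catA; case: (q) vq => [|c q'] /= /andP[/andP[vc _] _] [cv].
    by rewrite cv eqxx in vc.
  by rewrite cv eqxx in vc.
(* As [size q <= k], a window of [k.+1] letters beginning inside the copy of [q] or at the following
   [y] contains that [y]. *)
have h2 : sB <= sA + k.+1 + size q -> False.
  move=> BA; have : nth (v, false) tl (size q) = (v, true) by apply: run; lia.
  rewrite /tl -catA nth_cat size_map ltnn subnn /= => -[yv _].
  by have := yNq; rewrite yv mem_head.
have [j sBj] : exists j, sB = sA + k.+1 + (size q).+1 + j.
  by exists (sB - (sA + k.+1 + (size q).+1)); lia.
have [m mk] := fa2 j; apply/negP/negPn/eqP.
rewrite -[RHS](run ((size q).+1 + j + m)); last by lia.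
rewrite /tl nth_cat size_cat size_map /= addn1 -addnA ltnNge leq_addr /= addKn.
by [].
Qed.

Lemma run_free_drop i k w : run_free k w -> run_free k (drop i w).
Proof. by move=> fw j; have [m mk nm] := fw (i + j); exists m => //;
  rewrite nth_drop addnA. Qed.

Definition run_free_sphere k n : set (raag e) :=
  sphere n `&` [set g | run_free k (normal_form g)].

(** The place of insertion is recovered by applying [connect_words_size] in both directions, and
    then the two pieces by position. *)
Lemma card_run_free k n : size q <= k ->
  n.+1 * setcard (run_free_sphere k n) <= sphere_size (n + k + connector_size).
Proof.
move=> qk; have fA : finite_set (run_free_sphere k n).
  by apply: sub_finite_set (finite_sphere n) => g [].
rewrite -{1}(setcard_II n.+1) -setcardX //; try exact: finite_II.
pose F (p : nat * raag e) :=
  connect_words (take p.1 (normal_form p.2)) k (drop p.1 (normal_form p.2)).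
have nF p : normal_word (F p).
  have := normal_form_normal p.2;
    rewrite -{1}(cat_take_drop p.1 (normal_form p.2)) => np.
  apply: normal_connect_words; first by move: np; rewrite normal_cat => /andP[].
  by move: np; rewrite normal_cat => /andP[_ /normal_suffix].
apply: (setcard_inj (f := fun p => word_val e (F p))).
- by apply: finite_setX => //; exact: finite_II.
- exact: finite_sphere.
- move=> [i g] [/= _ [gn _]]; rewrite /word_sphere /= word_length_val_normal //.
  rewrite /F /connect_words !size_cat size_connector /=.
  have := congr1 size (cat_take_drop i (normal_form g)).
  by rewrite size_cat size_normal_form gn; lia.
- move=> [i g] [j h] /= [/= iN [gn fg]] [/= jN [hn fh]] /(congr1 normal_form).
  rewrite !word_valK // /F /= => E.
  have si : size (take i (normal_form g)) = i
    by rewrite size_takel // size_normal_form gn.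
  have sj : size (take j (normal_form h)) = j
    by rewrite size_takel // size_normal_form hn.
  have ij : i = j.
    have ji := connect_words_size qk (run_free_drop i fg) E.
    have := connect_words_size qk (run_free_drop j fh) (esym E).
    by move: ji; rewrite si sj; lia.
  move: E => /eqP; rewrite /connect_words eqseq_cat ?si ?sj //.
  rewrite eqseq_cat ?size_connector // => /and3P[/eqP t1 _ /eqP t2].
  congr pair => //; rewrite -(normal_formK g) -(normal_formK h).
  by rewrite -(cat_take_drop i (normal_form g)) t1 t2 cat_take_drop.
Qed.

Lemma card_no_long_run k n : size q <= k ->
  n.+1 * setcard (sphere n `&` [set g | ~ long_run g k.+1]) <=
  sphere_size (n + k + connector_size).
Proof.
move=> qk; apply: leq_trans (card_run_free n qk); rewrite leq_mul2l; apply/orP; right.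
apply: setcard_sub; first by apply: sub_finite_set (finite_sphere n) => g [].
move=> g [gn ng]; split=> //=; apply: contrapT => nf; apply: ng.
by rewrite -(normal_formK g); apply: run_long_run nf; exact: normal_form_normal.
Qed.

End SphereCounting.

(** * Growth and tail estimates *)

Section PureExponentialGrowth.
Set Implicit Arguments.
Unset Strict Implicit.

(** Were [a] larger than [b], the quotient of the powers would grow at least linearly by Bernoulli's
    inequality, which [bern] states without denominators, and pass [D]. *)
Lemma leq_of_expn_bound (a b D : nat) : (0 < b)%N ->
  (forall N, a ^ N.+1 <= D * b ^ N.+1)%N -> (a <= b)%N.
Proof.
move=> b0 h; rewrite leqNgt; apply/negP => ba.
have bern N : ((b + N) * b ^ N <= b * a ^ N)%N.
  elim: N => [|N IH]; first by rewrite !expn0; lia.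
  have ba' : (b ^ N * (b * b + b + N * b) <=
    b ^ N * ((b + N) * b.+1))%N by rewrite leq_mul2l; nia.
  have h1 : ((b + N) * b ^ N * b.+1 <= b * a ^ N * a)%N by exact: leq_mul.
  rewrite !expnS; nia.
have := bern (D * b).+1; have := h (D * b)%N.
have : (0 < b ^ (D * b).+1)%N by rewrite expn_gt0 b0.
nia.
Qed.

Variables (s : nat -> nat) (c : nat).
Hypothesis s_sub : forall m n, (s (m + n) <= s m * s n)%N.
Hypothesis s_super : forall m n, (s m * s n <= s (m + n + c))%N.
Hypothesis s1 : (1 < s 1)%N.

Lemma growth_expn_super i m : (s i ^ m.+1 <= s (m.+1 * i + m * c))%N.
Proof.
elim: m => [|m IH]; first by rewrite expn1 mul1n addn0.
rewrite expnS (leq_trans (leq_mul (leqnn _) IH)) // (leq_trans (s_super _ _)) //.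
by rewrite (_ : (_ + _ + c = m.+2 * i + m.+1 * c)%N) //; lia.
Qed.

Lemma growth_expn_sub n m i : (s (m * n + i) <= s n ^ m * s i)%N.
Proof.
elim: m => [|m IH]; first by rewrite mul1n.
rewrite mulSn -addnA (leq_trans (s_sub _ _)) // expnS -mulnA.
by rewrite leq_mul2l IH orbT.
Qed.

(** A power of [s 1] bounds from below the value of [s] at some larger argument, from which
    submultiplicativity splits off the factor [s n]. *)
Lemma growth_gt0 n : (0 < s n)%N.
Proof.
have h := growth_expn_super 1 n.
have : (0 < s (n + (1 + n * c)))%N.
  by rewrite (_ : (n + (1 + n * c) = n.+1 * 1 + n * c)%N); [apply: leq_trans h;
    rewrite expn_gt0 ltnW|lia].
by move=> /leq_trans /(_ (s_sub _ _)); rewrite muln_gt0 => /andP[].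
Qed.

(** Many blocks of length [i], joined at cost [c] each, make a length that is also cut into blocks
    of length [n.+1] and a remainder [n * c]. The remainder does not depend on the number of blocks,
    so it disappears in the limit. *)
Lemma growth_compare i n : (s i ^ n.+1 <= s n.+1 ^ (i + c))%N.
Proof.
apply: (leq_of_expn_bound (D := s (n * c))); first by rewrite expn_gt0 growth_gt0.
move=> N; rewrite -!expnM.
have := growth_expn_super i (n.+1 * N.+1).-1.
rewrite prednK ?muln_gt0 // => /leq_trans -> //.
have -> : (n.+1 * N.+1 * i + (n.+1 * N.+1).-1 * c =
    (N * (i + c) + i) * n.+1 + n * c)%N by nia.
rewrite (leq_trans (growth_expn_sub _ _ _)) // mulnC leq_mul2l; apply/orP; right.
by rewrite leq_pexp2l ?growth_gt0 //; nia.
Qed.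

Variable R : realType.
Hypothesis c0 : (0 < c)%N.

(** In logarithmic form [growth_compare] puts every [ln (s i) / (i + c)] below every
    [ln (s n.+1) / n.+1]; [L] is the supremum of the former. *)
Lemma growth_exponent : exists2 L : R, 0 < L &
  forall n, expR (n%:R * L) <= (s n)%:R <= expR ((n + c)%:R * L).
Proof.
have sR n : 0 < (s n)%:R :> R by rewrite ltr0n growth_gt0.
have ic i : 0 < (i + c)%:R :> R by rewrite ltr0n addn_gt0 c0 orbT.
pose A : set R := range (fun i : nat => ln (s i)%:R / (i + c)%:R).
have cmp i n : ln (s i)%:R / (i + c)%:R <= ln (s n.+1)%:R / n.+1%:R :> R.
  rewrite ler_pdivrMr // mulrAC ler_pdivlMr ?ltr0n //.
  rewrite !mulr_natr -!lnXn // ler_ln ?posrE ?exprn_gt0 // -!natrX ler_nat.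
  exact: growth_compare.
have ubA n : ubound A (ln (s n.+1)%:R / n.+1%:R) by move=> _ [i _ <-].
have leA i : ln (s i)%:R / (i + c)%:R <= sup A.
  by apply: ub_le_sup; [exists (ln (s 1)%:R / 1%:R); exact: ubA|exists i].
exists (sup A).
  apply: lt_le_trans (leA 1%N); apply: divr_gt0 => //.
  by apply: ln_gt0; rewrite ltr1n.
move=> n; rewrite -[(s n)%:R](lnK (sR n)) !ler_expR; apply/andP; split; last first.
  by rewrite mulrC -ler_pdivrMr.
(* The quotient by [n] says nothing at zero, where positivity of [s 0] suffices. *)
case: n => [|n]; first by rewrite mul0r ln_ge0 // ler1n growth_gt0.
rewrite mulrC -ler_pdivlMr ?ltr0n //; apply: ge_sup; last exact: ubA.
by exists (ln (s 0)%:R / (0 + c)%:R), 0.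
Qed.

End PureExponentialGrowth.

(** * Limits and tail bounds in terms of powers of n *)

Section LogarithmicEstimates.
Set Implicit Arguments.
Unset Strict Implicit.
Variable R : realType.
Implicit Types a L eps : R.

Lemma expR_ln_cvg0 a : 0 < a -> expR (- (a * ln (n%:R : R))) @[n --> \oo] --> 0.
Proof.
move=> a0; apply: (cvg_comp _ _ _ (@cvgr_expR R)).
apply/cvgryPge => A; near=> n.
have nA : expR (A / a) <= n%:R by near: n; exact: nbhs_infty_ger.
have n0 : 0 < n%:R :> R by apply: lt_le_trans nA; exact: expR_gt0.
by rewrite mulrC -ler_pdivrMr // -ler_expR lnK.
Unshelve. all: by end_near. Qed.

Lemma expR_lnN n : (0 < n)%N -> expR (- ln (n%:R : R)) = n%:R^-1.
Proof. by move=> n0; rewrite expRN lnK // posrE ltr0n. Qed.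

Lemma ln_succ_le n : (0 < n)%N -> ln (n.+1%:R : R) <= ln n%:R + 1.
Proof.
move=> n0; have nR : 0 < n%:R :> R by rewrite ltr0n.
rewrite -ler_expR expRD !lnK ?posrE ?ltr0n // mulrC.
apply: le_trans (ler_wpM2r (ltW nR) (expR_ge1Dx 1)).
by rewrite -natr1; have : 1 <= n%:R :> R; [rewrite ler1n|lra].
Qed.

Lemma ln_succ_div_cvg0 : ln (n.+1%:R : R) / n%:R @[n --> \oo] --> 0.
Proof.
apply: (@squeeze_cvgr _ _ _ _ (fun=> 0)
    (fun n : nat => (2 * expR 1) * expR (- (2^-1 * ln (n%:R : R)))) _); last 2 first.
- exact: cvg_cst.
- rewrite -[X in _ --> X](mulr0 (2 * expR 1)); apply: cvgMr.
  by apply: expR_ln_cvg0.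
near=> n.
have n0 : (0 < n)%N by near: n; exact: nbhs_infty_gt.
apply/andP; split; first by rewrite divr_ge0 // ln_ge0 // ler1n.
rewrite -expR_lnN //.
(* A crude bound of the logarithm by a multiple of the square root of [n], from
   [1 + x <= expR x]. *)
have h : ln (n.+1%:R : R) <= 2 * (expR 1 * expR (2^-1 * ln n%:R)).
  rewrite -expRD.
  have := ln_succ_le n0; have := expR_ge1Dx (1 + 2^-1 * ln (n%:R : R)); lra.
apply: le_trans (ler_wpM2r (expR_ge0 _) h) _.
rewrite mulrA -(mulrA _ (expR (_ * _))) -expRD.
by rewrite (_ : 2^-1 * ln n%:R + - ln n%:R = - (2^-1 * ln n%:R)) //; field.
Unshelve. all: by end_near. Qed.

(** The factor [n.+1] leaves room for summing spheres into a ball. After logarithms and division by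
    [n], it and the shift [c] contribute only [ln n.+1 / n] and [c * L / n]. *)
Lemma growth_rate_cvg (b : nat -> nat) L (c : nat) :
  (forall n, expR (n%:R * L) <= (b n)%:R <= n.+1%:R * expR ((n + c)%:R * L)) ->
  ((b n)%:R : R) `^ n%:R^-1 @[n --> \oo] --> expR L.
Proof.
move=> hb.
have b0 n : 0 < (b n)%:R :> R by case/andP: (hb n) => /(lt_le_trans (expR_gt0 _)).
have -> : (fun n => ((b n)%:R : R) `^ n%:R^-1) = expR \o (fun n => n%:R^-1 * ln (b
  n)%:R).
  by apply: funext => n; rewrite /= /powR gt_eqF.
apply: continuous_cvg; first exact: continuous_expR.
apply: (@squeeze_cvgr _ _ _ _ (fun=> L) (fun n : nat => L +
   (c%:R * L * expR (- (1 * ln (n%:R : R))) + ln (n.+1%:R : R) / n%:R))); last 2 first.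
- exact: cvg_cst.
- rewrite -[X in _ --> X]addr0; apply: cvgD; first exact: cvg_cst.
  rewrite -[X in _ --> X]addr0; apply: cvgD; last exact: ln_succ_div_cvg0.
  rewrite -[X in _ --> X](mulr0 (c%:R * L)); apply: cvgMr.
  by apply: expR_ln_cvg0.
near=> n.
have n0 : (0 < n)%N by near: n; exact: nbhs_infty_gt.
have nR : 0 < n%:R :> R by rewrite ltr0n.
have /andP[h1 h2] := hb n.
rewrite mul1r expR_lnN //; apply/andP; split.
  by rewrite mulrC ler_pdivlMr // mulrC -ler_expR lnK ?posrE.
rewrite mulrC ler_pdivrMr // !mulrDl -[_ * _ * n%:R]mulrA mulVf ?gt_eqF // mulr1.
rewrite divfK ?gt_eqF //.
apply: (@le_trans _ _ (ln (n.+1%:R * expR ((n + c)%:R * L)))).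
  by rewrite ler_ln ?posrE // mulr_gt0 ?expR_gt0.
by rewrite lnM ?posrE ?expR_gt0 // expRK natrD mulrDl; lra.
Unshelve. all: by end_near. Qed.

(** The threshold makes [expR (- k L)] at most [n ^ (- 1 - eps L)]. One power of [n] absorbs the
    number of positions, and 4 comes from [n.+1 <= 2 n]. *)
Lemma upper_tail_bound L eps (c n k : nat) : 0 < L -> (0 < n)%N ->
  (L^-1 + eps) * ln n%:R <= k%:R ->
  2 * n.+1%:R * expR ((n%:R - k%:R + c%:R) * L) / expR (n%:R * L) <=
  4 * expR (c%:R * L) * expR (- (eps * L * ln (n%:R : R))).
Proof.
move=> L0 n0 hk; have nR : 1 <= n%:R :> R by rewrite ler1n.
have nE : n%:R = expR (ln (n%:R : R)) by rewrite lnK // posrE ltr0n.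
rewrite -expRN -[_ * _ * expR (- _)]mulrA -expRD -(mulrA 4) -expRD.
set E := expR _; set F := expR (_ + _).
have EF : n%:R * E <= F.
  rewrite nE -expRD ler_expR.
  have := ler_wpM2r (ltW L0) hk.
  have -> : (L^-1 + eps) * ln n%:R * L = ln n%:R + eps * L * ln n%:R by field;
    rewrite gt_eqF.
  lra.
have : E <= n%:R * E by rewrite ler_peMl // expR_ge0.
rewrite -natr1; lra.
Qed.

(** The threshold is cut off at 0 because [L^-1 - eps] may be negative. The two summands on the
    right answer to the two values of the maximum: [n ^ (- 1)] when it is 0, [n ^ (- eps L)]
    otherwise. *)
Lemma lower_tail_bound L eps (c n k m : nat) : 0 < L -> (0 < n)%N ->
  k%:R <= Num.max ((L^-1 - eps) * ln n%:R) 0 + m%:R ->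
  expR ((n + k + c)%:R * L) / n.+1%:R / expR (n%:R * L) <=
  expR ((m + c)%:R * L) *
    (expR (- (1 * ln (n%:R : R))) + expR (- (eps * L * ln (n%:R : R)))).
Proof.
move=> L0 n0 hk.
have nR : 0 < n%:R :> R by rewrite ltr0n.
rewrite mul1r expR_lnN // mulrAC -expRN -expRD.
apply: (@le_trans _ _ (expR ((k + c)%:R * L) / n%:R)).
  rewrite (_ : (n + k + c)%:R * L - n%:R * L = (k + c)%:R * L); last first.
    by rewrite !natrD; ring.
  by rewrite ler_pM2l ?expR_gt0 // lef_pV2 ?posrE ?ltr0n // ler_nat.
rewrite mulrDr -expR_lnN // -!expRD.
move: hk; rewrite maxEle; case: ifP => _ hk.
  apply: ler_wpDr; first exact: expR_ge0.
  rewrite ler_expR lerD2r ler_pM2r // !natrD; lra.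
apply: ler_wpDl; first exact: expR_ge0.
rewrite ler_expR; have := ler_wpM2r (ltW L0) hk.
rewrite mulrDl.
have -> : (L^-1 - eps) * ln n%:R * L = ln n%:R - eps * L * ln n%:R by field;
  rewrite gt_eqF.
rewrite !natrD; lra.
Qed.

End LogarithmicEstimates.

(** * Convergence in probability *)

Section CoveringWalks.
Set Implicit Arguments.
Unset Strict Implicit.
Local Open Scope nat_scope.
Variables (V : finType) (f : rel V).
Hypothesis f_connect : forall x z, connect f x z.

Lemma visiting_path (s : seq V) x : exists2 p, path f x p & {subset s <= x :: p}.
Proof.
elim: s x => [|a s IH] x; first by exists [::].
have /connectP[p xp ap] := f_connect x a; have [p' ap' sp'] := IH a.
exists (p ++ p'); first by rewrite cat_path xp -ap.
have ax : a \in x :: p by rewrite ap mem_last.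
move=> z; rewrite inE -cat_cons mem_cat => /orP[/eqP -> |/sp']; first by rewrite ax.
by rewrite inE => /orP[/eqP ->|->]; rewrite ?ax ?orbT.
Qed.

(** A shortest walk covering all vertices ends at a vertex not met before, since otherwise its last
    step could be dropped; with two vertices it has at least one step. *)
Lemma covering_path v : 1 < #|V| -> exists q y,
  [/\ path f v (rcons q y), forall z, z \in v :: rcons q y & y \notin v :: q].
Proof.
move=> V2.
pose P n := `[< exists p, [/\ size p = n, path f v p & forall z, z \in v :: p] >].
have exP : exists n, P n.
  have [p vp pV] := visiting_path (enum V) v.
  by exists (size p); apply/asboolP; exists p; split=> // z; apply: pV;
    rewrite mem_enum.
case: (ex_minnP exP) => n /asboolP[p []]; case/lastP: p => [|q y] pn vp pV nmin.
  have : #|V| <= #|pred1 v| by apply/subset_leq_card/fintype.subsetP => z _;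
    have := pV z; rewrite !inE.
  by rewrite card1 leqNgt V2.
exists q, y; split=> //; apply/negP => yq.
suff /nmin : P (size q) by rewrite -pn size_rcons ltnn.
apply/asboolP; exists q; split=> //; first by move: vp; rewrite rcons_path => /andP[].
by move=> z; have := pV z; rewrite inE mem_rcons inE => /or3P[/eqP->|/eqP->|zq] //;
  rewrite inE ?eqxx ?zq ?orbT.
Qed.

Lemma return_path y v : y != v -> exists r, path f y (rcons r v).
Proof.
move=> yv; have /connectP[p yp pv] := f_connect y v.
case/lastP: p yp pv => [|r z] yp; rewrite ?last_rcons => vE;
  first by rewrite vE eqxx in yv.
by exists r; rewrite vE.
Qed.

End CoveringWalks.

(** * Probability of a deviation of the excursion *)

Section Main.
Set Implicit Arguments.
Unset Strict Implicit.
Variables (R : realType) (V : finType) (e : rel V).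
Hypotheses (e_sym : symmetric e) (e_irr : irreflexive e).
Variable v : V.

Local Notation sphere := (word_sphere (raag_gens e)).
Local Notation exc := (excursion R (raag_gens e) (cyclic_subgroup (raag_vertex e v))).
Local Notation s := (sphere_size e).

Variables (L : R) (c m : nat).
Hypothesis L0 : 0 < L.
Hypothesis s_exp : forall n, expR (n%:R * L) <= (s n)%:R <= expR ((n + c)%:R * L).
Hypothesis no_long : forall n k, (m <= k)%N ->
  (n.+1 * setcard (sphere n `&` [set g | ~ long_run v g k.+1]) <= s (n + k + c))%N.

(** At most [n.+1] products of two sphere sizes are summed, and each factor costs one [c] in the
    exponent. For [k] beyond [n] the set is empty. *)
Lemma card_long_run_le n k :
  (setcard (sphere n `&` [set g | long_run v g k]))%:R <=
  2 * n.+1%:R * expR ((n%:R - k%:R + (c + c)%:R) * L) :> R.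
Proof.
have [kn|nk] := leqP k n; last first.
  rewrite (_ : _ `&` _ = set0) ?/setcard ?fset_set0 ?cardfs0.
    by rewrite !mulr_ge0 ?expR_ge0.
  rewrite -subset0 => g [gn /long_run_le]; rewrite (gn : word_length _ g = n).
  by rewrite leqNgt nk.
apply: (@le_trans _ _ (2 * \sum_(i < (n - k).+1) (s i)%:R * (s (n - k - i))%:R)).
  under eq_bigr do rewrite -natrM.
  rewrite -natr_sum -natrM ler_nat; exact: card_long_run.
rewrite -mulrA ler_pM2l //.
apply: (@le_trans _ _ (\sum_(i < (n - k).+1) expR ((n%:R - k%:R + (c + c)%:R) * L))).
  apply: ler_sum => i _.
  have /andP[_ h1] := s_exp i; have /andP[_ h2] := s_exp (n - k - i).
  apply: le_trans (ler_pM _ _ h1 h2) _ => //.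
  rewrite -expRD ler_expR -mulrDl -natrD -natrB // -natrD ler_pM2r // ler_nat.
  by have := ltn_ord i; lia.
rewrite sumr_const card_ord -[leLHS]mulr_natl ler_pM2r ?expR_gt0 // ler_nat ltnS.
exact: leq_subr.
Qed.

Lemma excursion_deviation_le eps n : 0 < eps -> (1 < n)%N ->
  uniform_proba R (sphere n) [set g | eps < `|exc g / ln n%:R - 1 / L|] <=
  4 * expR ((c + c)%:R * L) * expR (- (eps * L * ln (n%:R : R))) +
  expR ((m + (c + c))%:R * L) *
    (expR (- (1 * ln (n%:R : R))) + expR (- (eps * L * ln (n%:R : R)))).
Proof.
move=> eps0 n1; have n0 : (0 < n)%N by exact: ltnW.
have ln0 : 0 < ln (n%:R : R) by apply: ln_gt0; rewrite ltr1n.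
pose T1 := (L^-1 + eps) * ln (n%:R : R).
pose T2 := Num.max ((L^-1 - eps) * ln (n%:R : R)) 0.
have T10 : 0 <= T1 by rewrite mulr_ge0 ?ltW // addr_gt0 // invr_gt0.
have T20 : 0 <= T2 by rewrite le_max lexx orbT.
(* [k1] is the least run length exceeding [T1]. Adding [m] makes [no_long] applicable at [k2] and
   costs only a constant factor. *)
pose k1 := (Num.truncn T1).+1; pose k2 := (Num.truncn T2 + m)%N.
pose A1 := sphere n `&` [set g | long_run v g k1].
pose A2 := sphere n `&` [set g | ~ long_run v g k2.+1].
have fA1 : finite_set A1 by apply: sub_finite_set (finite_sphere e_sym e_irr n) => g [].
have fA2 : finite_set A2 by apply: sub_finite_set (finite_sphere e_sym e_irr n) => g [].
(* Outside [A1] every run is at most [T1] long, and outside [A2] some run is longer than [T2], so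
   the excursion lies between the two. *)
have sub : sphere n `&` [set g | eps < `|exc g / ln n%:R - 1 / L|] `<=` A1 `|` A2.
  move=> g [/= gn]; rewrite div1r.
  have [lg|nlg] := pselect (long_run v g k2.+1); last by right.
  move=> dev; left; split=> //=; apply: contrapT => nlg.
  have e1 : exc g <= T1.
    apply: excursion_le => // k lk; rewrite leNgt; apply/negP => T1k.
    apply: nlg; apply: long_run_mono lk => //.
    by rewrite /k1 truncn_lt_nat.
  have e2 : T2 <= exc g.
    apply: le_trans (excursion_ge e_sym e_irr R lg).
    apply: ltW; apply: lt_le_trans (truncnS_gt T2) _.
    by rewrite ler_nat /k2 ltnS leq_addr.
  move: dev; rewrite ltNge => /negP; apply.
  rewrite ler_distl; apply/andP; split.
    rewrite ler_pdivlMr //; apply: le_trans e2.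
    by rewrite /T2 le_max lexx.
  by rewrite ler_pdivrMr.
have sn0 : 0 < (s n)%:R :> R by case/andP: (s_exp n) => /(lt_le_trans (expR_gt0 _)).
apply: (@le_trans _ _ (((setcard A1)%:R + (setcard A2)%:R) / expR (n%:R * L))).
  rewrite /uniform_proba -/(setcard _) -/(setcard _) -/(s n).
  apply: ler_pM; rewrite ?invr_ge0 ?ler0n //.
    rewrite -natrD ler_nat; apply: leq_trans (setcardU fA1 fA2).
    by apply: setcard_sub => //; rewrite finite_setU.
  by rewrite lef_pV2 ?posrE ?expR_gt0 //; case/andP: (s_exp n).
rewrite mulrDl; apply: lerD.
  apply: le_trans (upper_tail_bound (k := k1) _ L0 n0 _).
    by rewrite ler_pM2r ?invr_gt0 ?expR_gt0 //; exact: card_long_run_le.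
  exact/ltW/truncnS_gt.
apply: le_trans (lower_tail_bound (k := k2) _ L0 n0 _); last first.
  by rewrite /k2 natrD lerD2r truncn_le.
rewrite ler_pM2r ?invr_gt0 ?expR_gt0 // ler_pdivlMr ?ltr0n // mulrC -natrM.
apply: (@le_trans _ _ (s (n + k2 + c))%:R).
  by rewrite ler_nat; apply: no_long; rewrite leq_addl.
by rewrite addnA; case/andP: (s_exp (n + k2 + c)).
Qed.

End Main.

Theorem corollary2 (R : realType) (V : finType) (e : rel V)
    (e_sym : symmetric e) (e_irr : irreflexive e)
    (nonelementary : (1 < #|V|)%N) (irreducible : raag_irreducible e) (v : V) :
  let S := raag_gens e in
  let H := cyclic_subgroup (raag_vertex e v) in
  let lambda := growth_rate S R in
  uniform_cvg_in_proba (word_sphere S)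
    (fun n g => excursion R S H g / ln (n%:R : R)) (1 / ln lambda).
Proof.
move=> S H lambda.
have [q [y [vq cover yNq]]] := covering_path irreducible v nonelementary.
have yv : y != v by apply: contraNneq yNq => ->; rewrite mem_head.
have [r yr] := return_path irreducible yv.
pose c := connector_size q r.
have [L L0 sL] := @growth_exponent (sphere_size e) c (sphere_size_sub e_sym e_irr)
  (sphere_size_super e_sym e_irr vq cover yNq yr) (sphere_size1 e_sym e_irr v) R isT.
have lamE : lambda = expR L.
  apply/cvg_lim => //; apply: (@growth_rate_cvg R _ L c) => n.
  (* The ball is squeezed between its outermost sphere and the sum of its [n.+1] spheres. *)
  have [_ /andP[h1 h2]] := word_ball_bounds e_sym e_irr n.
  apply/andP; split.
    by apply: (@le_trans _ _ (sphere_size e n)%:R); [case/andP: (sL n)|rewrite ler_nat].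
  apply: (@le_trans _ _ (\sum_(i < n.+1) sphere_size e i)%:R); first by rewrite ler_nat.
  rewrite natr_sum; apply: (@le_trans _ _ (\sum_(i < n.+1) expR ((n + c)%:R * L))).
    apply: ler_sum => i _; have /andP[_ /le_trans->] // := sL i.
    by rewrite ler_expR ler_pM2r // ler_nat leq_add2r -ltnS.
  by rewrite sumr_const card_ord -[leLHS]mulr_natl.
rewrite lamE expRK => eps eps0.
(* The offset [m] of the deviation bound is [size q]: runs inserted with [k] at least that large can
   be located again. *)
have no_long n k : (size q <= k)%N -> (n.+1 *
    setcard (word_sphere S n `&` [set g | ~ long_run v g k.+1]) <=
      sphere_size e (n + k + c))%N.
  exact: (card_no_long_run e_sym e_irr vq cover yNq yr n).
have epsL : 0 < eps * L by rewrite mulr_gt0.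
apply: (@squeeze_cvgr _ _ _ _ (fun=> 0) (fun n : nat =>
  4 * expR ((c + c)%:R * L) * expR (- (eps * L * ln (n%:R : R))) +
  expR ((size q + (c + c))%:R * L) *
    (expR (- (1 * ln (n%:R : R))) + expR (- (eps * L * ln (n%:R : R)))))); last 2 first.
- exact: cvg_cst.
- rewrite -[X in _ --> X]addr0; apply: cvgD.
    rewrite -[X in _ --> X](mulr0 (4 * expR ((c + c)%:R * L))); apply: cvgMr.
    exact: expR_ln_cvg0.
  rewrite -[X in _ --> X](mulr0 (expR ((size q + (c + c))%:R * L))); apply: cvgMr.
  rewrite -[X in _ --> X]addr0; apply: cvgD; exact: expR_ln_cvg0.
near=> n; apply/andP; split; first by rewrite divr_ge0.
apply: (excursion_deviation_le e_sym e_irr L0 sL no_long) => //.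
by near: n; exact: nbhs_infty_gt.
Unshelve. all: by end_near. Qed.
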